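(* Let $X$ be a nonsingular real algebraic surface and let $f_1,\ldots,f_r$ be continuous rational functions on $X$. For a continuous rational function $\varphi$ on $X$, the following conditions are equivalent: (a) The function $\varphi$ can be written in the form $\varphi=\varphi_1f_1+\cdots+\varphi_rf_r$, where the $\varphi_i$ are continuous rational functions on $X$. (b) The function $\varphi$ satisfies the pointwise test (PT) for the functions $f_1,\ldots,f_r$. Furthermore, if (b) holds, then the $\varphi_i$ in (a) can be chosen so that each $P(\varphi_i)$ is a finite set contained in $Z(f_1,\ldots,f_r)\cup P(f_1)\cup\ldots\cup P(f_r)\cup P(\varphi)$.
   Context: All functions are real-valued. A real algebraic variety is a locally ringed space isomorphic to an algebraic subset of $\mathbb{R}^n$, for some $n$, endowed with the Zariski topology and the sheaf of regular functions (what is often called an affine real algebraic variety). A real algebraic surface is a real algebraic variety of dimension $2$; it is not assumed irreducible. Each real algebraic variety also carries the Euclidean topology, and all topological notions (in particular continuity) refer to the Euclidean topology unless ''Zariski'' is explicitly mentioned. A function $f$ on a real algebraic variety $X$ is continuous rational if it is continuous on $X$ and regular on some Zariski open dense subset of $X$; $P(f)$ denotes the smallest Zariski closed subset of $X$ such that $f$ is regular on $X\setminus P(f)$. $Z(f_1,\ldots,f_r)$ denotes the common zero set $\{x\in X\mid f_1(x)=0,\ldots,f_r(x)=0\}$. Pointwise test: let $\Omega$ be a metric space and $f_1,\ldots,f_r$ continuous functions on $\Omega$. A continuous function $\varphi$ on $\Omega$ satisfies the PT for the $f_i$ if for every point $p\in\Omega$ the function $\varphi$ can be written as $\varphi=\psi_1^{(p)}f_1+\cdots+\psi_r^{(p)}f_r$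 on $\Omega$, where the $\psi_i^{(p)}$ are functions on $\Omega$ (not necessarily continuous everywhere) that are continuous at $p$. *)

(* Defs.v *)
From HB Require Import structures.
From mathcomp Require Import all_boot all_order all_algebra.
From mathcomp Require Import all_classical all_reals all_analysis.
From mathcomp Require mpoly.
Import Order.TTheory GRing.Theory Num.Theory.
Import numFieldNormedType.Exports.

Set Implicit Arguments.
Unset Strict Implicit.
Unset Printing Implicit Defensive.

Local Open Scope classical_set_scope.
Local Open Scope ring_scope.

(* Real algebraic varieties are taken embedded, as algebraic subsets X of R^n
   ('rV[R]_n, with its product topology as Euclidean topology).  A function on
   X is represented by a total function on R^n of which only the values on X
   matter. *)

Notation rpoly R n := (mpoly.mpoly n R).

Definition peval (R : realType) (n : nat) (p : rpoly R n) (x : 'rV[R]_n) : R :=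
  mpoly.meval (fun j => x ord0 j) p.

Section Zariski.
Variables (R : realType) (n : nat).
Implicit Types (X A B C U V : set 'rV[R]_n).

Definition zariski_closed A : Prop :=
  exists S : set (rpoly R n), A = [set x | forall p, S p -> peval p x = 0].

Definition zariski_open_in X U : Prop :=
  exists2 A, zariski_closed A & U = X `\` A.

Definition zariski_dense_in X U : Prop :=
  forall A, zariski_closed A -> U `<=` A -> X `<=` A.

Definition zariski_irreducible A : Prop :=
  [/\ zariski_closed A, A !=set0 &
      forall B C, zariski_closed B -> zariski_closed C ->
        A = B `|` C -> A = B \/ A = C].

Definition irreducible_chain X (d : nat) (Z : nat -> set 'rV[R]_n) : Prop :=
  (forall i, (i <= d)%N -> zariski_irreducible (Z i) /\ Z i `<=` X) /\
  (forall i, (i < d)%N -> Z i `<` Z i.+1).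

(* Krull dimension, for X Zariski closed *)
Definition zariski_dim X (d : nat) : Prop :=
  (exists Z, irreducible_chain X d Z) /\
  (forall e Z, irreducible_chain X e Z -> (e <= d)%N).

Definition jacobian (c : nat) (P : 'I_c -> rpoly R n) (x : 'rV[R]_n) :
    'M[R]_(c, n) :=
  \matrix_(i, j) peval (mpoly.mderiv j (P i)) x.

(* The Jacobian condition expressing that the local ring of X at x is regular
   of dimension d = n - c. *)
Definition nonsingular_at X (d : nat) (x : 'rV[R]_n) : Prop :=
  exists (c : nat) (P : 'I_c -> rpoly R n),
    [/\ (c + d = n)%N,
        forall i y, X y -> peval (P i) y = 0,
        \rank (jacobian P x) = c &
        exists2 U, zariski_open_in [set: 'rV[R]_n] U &
          U x /\ X `&` U = [set y | forall i, peval (P i) y = 0] `&` U].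

(* Neither irreducibility nor pure dimensionality is required.  The bound
   d <= 2 is no restriction, as the dimension of X at x is at most dim X. *)
Definition nonsingular_surface X : Prop :=
  [/\ zariski_closed X, zariski_dim X 2 &
      forall x, X x -> exists2 d, (d <= 2)%N & nonsingular_at X d x].

(* f is a section over U (Zariski open in X) of the sheaf of regular
   functions of X. *)
Definition regular_on X U (f : 'rV[R]_n -> R) : Prop :=
  forall x, U x -> exists V (p q : rpoly R n),
    [/\ zariski_open_in X V, V x, V `<=` U &
        forall y, V y -> peval q y != 0 /\ f y = peval p y / peval q y].

Definition continuous_rational X (f : 'rV[R]_n -> R) : Prop :=
  {within X, continuous f} /\
  exists U, [/\ zariski_open_in X U, zariski_dense_in X U & regular_on X U f].

Definition admissible_pole X (f : 'rV[R]_n -> R) A : Prop :=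
  [/\ zariski_closed A, A `<=` X & regular_on X (X `\` A) f].

(* P(f); it is indeed the smallest such set by admissible_pole_set below. *)
Definition pole_set X (f : 'rV[R]_n -> R) : set 'rV[R]_n :=
  \bigcap_(A in admissible_pole X f) A.

Definition zero_set X (r : nat) (f : 'I_r -> 'rV[R]_n -> R) : set 'rV[R]_n :=
  [set x | X x /\ forall i, f i x = 0].

Lemma admissible_pole_set X (f : 'rV[R]_n -> R) :
  zariski_closed X -> admissible_pole X f (pole_set X f).
Proof.
move=> Xc; have XX : admissible_pole X f X.
  by split=> // x; rewrite setDv.
split.
- exists [set p | exists2 A, admissible_pole X f A &
                   forall x, A x -> peval p x = 0].
  apply/seteqP; split=> [x Px p [A fA Ap]|x Hx A fA]; first exact: Ap (Px A fA).
  have [[S SE] _ _] := fA; rewrite SE => p Sp.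
  by apply: Hx; exists A => // y; rewrite SE; apply.
- by move=> x; apply.
- move=> x [Xx /existsNP[A /not_implyP[fA nAx]]].
  have [_ _ /(_ x (conj Xx nAx))[V [p [q [Vo Vx VU Vpq]]]]] := fA.
  exists V, p, q; split=> // y /VU[Xy nAy]; split=> // Py.
  exact: nAy (Py A fA).
Qed.

End Zariski.

(* The pointwise test on the subspace Omega of T *)
Definition pointwise_test (R : realType) (T : topologicalType) (Omega : set T)
    (r : nat) (f : 'I_r -> T -> R) (phi : T -> R) : Prop :=
  forall p, Omega p -> exists psi : 'I_r -> T -> R,
    (forall i, psi i x @[x --> within Omega (nbhs p)] --> psi i p) /\
    (forall x, Omega x -> phi x = \sum_(i < r) psi i x * f i x).

(* Main.v *)
(** Off the poles, the solution of least norm of phi = sum_i g_i f_i is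
    f_i phi / |f|^2.  It is not continuous in general, but under the pointwise test
    phi = O(|f|) locally, so the functions a_i = f_i phi / |f|^2 and
    b_ij = f_i f_j / |f|^2 are locally bounded.  On a nonsingular surface a locally
    bounded function that is regular on a Zariski dense open set extends to a regular
    function off a finite set S.  With polynomials c_j interpolating on S the values
    psi_j^(p)(p) provided by the pointwise test, g_i = c_i + a_i - sum_j c_j b_ij
    solves the equation, and it extends continuously to S because
    phi - sum_j c_j f_j = o(|f|) at each point of S.

    For the extension theorem, suppose that the common zeros of the denominators of a
    bounded function g form an infinite set, and let C be a minimal infinite algebraic
    subset of it; its ideal is prime.  At a suitable point x of C the variety X is a
    surface, on which C is cut out by one local equation t.  If q g = p near x, then
    q and, by boundedness, p vanish on C, hence both are divisible by t and q / t is
    again a denominator of g near x.  By Nakayama's lemma all denominators of g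
    vanish near x, which is absurd.  That C is smooth of dimension one at x and that
    its ideal is generated as expected follows from the polynomial inverse function
    theorem, Gronwall's inequality and Nakayama's lemma. *)

Require Import Defs.
From HB Require Import structures.
From mathcomp Require Import all_boot all_order all_algebra.
From mathcomp Require Import all_classical all_reals all_analysis.
From mathcomp Require mpoly.
From mathcomp Require Import ring lra zify.
Import (canonicals, coercions) mpoly.
Import Order.TTheory GRing.Theory Num.Theory.
Import numFieldNormedType.Exports.

Set Implicit Arguments.
Unset Strict Implicit.
Unset Printing Implicit Defensive.

Local Open Scope classical_set_scope.
Local Open Scope ring_scope.

(** * Hilbert's basis theorem *)

(** Course-of-values recursion: [L k] is the list of the first [k] values. It serves choices that
    must avoid the ideal of all earlier ones. *)
Lemma seq_rec_exists (T : Type) (next : seq T -> T) :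
  exists q : nat -> T, forall k, q k = next (mkseq q k).
Proof.
pose L := fix L k := if k is k'.+1 then rcons (L k') (next (L k')) else [::].
exists (fun k => next (L k)) => k; congr next.
elim: k => [|k IH] //=.
by rewrite {1}IH /mkseq -[in RHS]addn1 iotaD map_cat /= cats1.
Qed.

(** Each new index minimises [u] on the tail beyond the previous one; such an index exists because
    the naturals are well-ordered. *)
Lemma nat_nondecreasing_subseq (u : nat -> nat) :
  exists phi : nat -> nat, {homo phi : i j / (i < j)%N} /\
    {homo u \o phi : i j / (i <= j)%N}.
Proof.
have min_tail N : exists k, (N <= k)%N /\ forall j, (N <= j)%N -> (u k <= u j)%N.
  have ex : exists v, `[< exists2 k, (N <= k)%N & u k = v >].
    by exists (u N); apply/asboolP; exists N.
  case: (ex_minnP ex) => v /asboolP[k Nk <-] vmin.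
  by exists k; split=> // j Nj; apply: vmin; apply/asboolP; exists j.
have [m mP] := choice min_tail.
pose phi := fix phi i := if i is i'.+1 then m (phi i').+1 else m 0%N.
have phiS i : (phi i < phi i.+1)%N by case: (mP (phi i).+1).
have uphiS i : (u (phi i) <= u (phi i.+1))%N.
  case: i => [|i]; first exact: (mP 0%N).2.
  by apply: (mP (phi i).+1).2; apply: leq_trans (phiS i.+1); apply: ltnW (phiS i).
exists phi; split; first exact: (homo_ltn ltn_trans phiS).
exact: (homo_leq leqnn leq_trans uphiS).
Qed.

(** Dickson's lemma: extracting a subsequence for each of the [n] exponents in turn makes all of
    them nondecreasing, so that its first two terms are comparable. *)
Lemma dickson (n : nat) (u : nat -> mpoly.multinom n) :
  exists i j, (i < j)%N /\ mpoly.lem (u i) (u j).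
Proof.
have sub (s : seq 'I_n) : exists phi : nat -> nat, {homo phi : i j / (i < j)%N} /\
    forall c, c \in s -> forall i j, (i <= j)%N -> (u (phi i) c <= u (phi j) c)%N.
  elim: s => [|c s [phi [phi_lt phiP]]]; first by exists id; split.
  have [psi [psi_lt psiP]] := nat_nondecreasing_subseq (fun i => u (phi i) c).
  exists (phi \o psi); split=> [i j /psi_lt/phi_lt //|d].
  rewrite inE => /predU1P[-> i j /psiP //|ds i j ij /=].
  by apply: phiP => //; rewrite (ltnW_homo psi_lt).
have [phi [phi_lt phiP]] := sub (enum 'I_n).
exists (phi 0%N), (phi 1%N); split; first exact: phi_lt.
by apply/forallP => c; apply: phiP; rewrite ?mem_enum.
Qed.

Section Hilbert.
Variables (F : fieldType) (n : nat).
Local Notation poly := (mpoly.mpoly n F).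
Implicit Types (p q h : poly) (l : seq poly) (S : set poly).

Definition in_ideal l h :=
  exists a : nat -> poly, h = \sum_(i < size l) a i * l`_i.

Lemma in_idealD l h1 h2 : in_ideal l h1 -> in_ideal l h2 -> in_ideal l (h1 + h2).
Proof.
move=> [a ->] [b ->]; exists (a \+ b).
by rewrite -big_split; apply: eq_bigr => i _; rewrite mulrDl.
Qed.

Lemma in_idealM l h w : in_ideal l h -> in_ideal l (w * h).
Proof.
move=> [a ->]; exists (fun i => w * a i).
by rewrite mulr_sumr; apply: eq_bigr => i _; rewrite mulrA.
Qed.

Lemma in_idealB l h1 h2 : in_ideal l h1 -> in_ideal l h2 -> in_ideal l (h1 - h2).
Proof. by move=> ? ?; rewrite -mulN1r; apply/in_idealD/in_idealM. Qed.

Lemma in_ideal0 l : in_ideal l 0.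
Proof. by exists (fun=> 0); rewrite big1 // => i _; rewrite mul0r. Qed.

Lemma in_ideal_sum (I : Type) (r : seq I) (P : pred I) (G : I -> poly) l :
  (forall i, P i -> in_ideal l (G i)) -> in_ideal l (\sum_(i <- r | P i) G i).
Proof.
by move=> lG; elim/big_ind : _ => //; [apply: in_ideal0 | move=> ? ?; apply: in_idealD].
Qed.

Lemma in_ideal_mem l h : h \in l -> in_ideal l h.
Proof.
move=> /(nthP 0)[i il <-]; exists (fun j => (j == i)%:R).
rewrite (bigD1 (Ordinal il)) //= eqxx mul1r big1 ?addr0 // => j ji.
by rewrite -val_eqE /= in ji; rewrite (negPf ji) mul0r.
Qed.

Lemma in_ideal_trans l l' h :
  (forall q, q \in l -> in_ideal l' q) -> in_ideal l h -> in_ideal l' h.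
Proof.
move=> ll' [a ->]; apply: in_ideal_sum => i _; apply: in_idealM.
by apply: ll'; rewrite mem_nth.
Qed.

(** One division step: [w] is the quotient of the leading terms, so [w * p] cancels the leading term
    of [q]. *)
Lemma mlead_reduce p q : p != 0 -> q != 0 -> mpoly.lem (mpoly.mlead p) (mpoly.mlead q) ->
  exists w, q - w * p = 0 \/ (mpoly.mlead (q - w * p) < mpoly.mlead q)%O.
Proof.
move=> p0 q0 pq.
set mp := mpoly.mlead p; set mq := mpoly.mlead q.
pose c := mpoly.mcoeff mq q / mpoly.mcoeff mp p.
have lp0 : mpoly.mcoeff mp p != 0 by rewrite mpoly.mleadc_eq0.
have lq0 : mpoly.mcoeff mq q != 0 by rewrite mpoly.mleadc_eq0.
have c0 : c != 0 by rewrite mulf_neq0 // invr_eq0.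
pose X := mpoly.mpolyX F (mpoly.mnm_sub mq mp).
have lX : mpoly.mlead (c *: X) = mpoly.mnm_sub mq mp.
  rewrite mpoly.mleadZ_proper mpoly.mleadXm //.
  by rewrite mpoly.mcoeffX eqxx mulr1.
have w0 : c *: X != 0.
  by rewrite -mpoly.mleadc_eq0 lX mpoly.mcoeffZ mpoly.mcoeffX eqxx mulr1.
have lw : mpoly.mlead (c *: X * p) = mq.
  by rewrite mpoly.mleadM // lX mpoly.submK.
exists (c *: X); set r := q - _.
have [->|r0] := eqVneq r 0; first by left.
right; rewrite lt_neqAle; apply/andP; split; last first.
  by apply: le_trans (mpoly.mleadB_le _ _) _; rewrite lw joinxx.
apply: contra_neq r0 => lr; apply/eqP; rewrite -mpoly.mleadc_eq0 lr.
rewrite mpoly.mcoeffB -/mq -[in X in _ - X]lw mpoly.mleadM // mpoly.mleadcM lX.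
rewrite mpoly.mcoeffZ mpoly.mcoeffX eqxx mulr1 /c divfK //.
by rewrite subrr.
Qed.

(* If no [p N] were redundant, one could choose [q k] of least leading monomial
   among the members of the ideal of the [p i] outside (q_0, ..., q_(k-1));
   Dickson's lemma yields i < j such that q_j can be reduced by q_i, against the
   minimality of q_j. *)
Lemma hilbert_seq (p : nat -> poly) : exists N, in_ideal (mkseq p N) (p N).
Proof.
apply: contrapT => /forallNP np.
pose I h := exists N, in_ideal (mkseq p N) h.
have Isub N M h : (N <= M)%N -> in_ideal (mkseq p N) h -> in_ideal (mkseq p M) h.
  move=> NM; apply: in_ideal_trans => q /mapP[i iN ->]; apply/in_ideal_mem/map_f.
  by move: iN; rewrite !mem_iota /= !add0n => /leq_trans; apply.
have Inext l : exists h, (forall q, q \in l -> I q) ->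
    [/\ I h, ~ in_ideal l h &
      forall h', I h' -> ~ in_ideal l h' -> (mpoly.mlead h <= mpoly.mlead h')%O].
  have [lI|] := pselect (forall q, q \in l -> I q); last by exists 0.
  have [h0 [Ih0 lh0]] : exists h, I h /\ ~ in_ideal l h.
    apply: contrapT => /forallNP all_l.
    have [M lM] : exists M, forall q, q \in l -> in_ideal (mkseq p M) q.
      elim: l lI {all_l} => [|q l IH] lI; first by exists 0%N.
      have [M lM] := IH (fun q' q'l => lI q' (@mem_behead _ (q :: l) _ q'l)).
      have [N qN] := lI q (mem_head _ _).
      exists (maxn M N) => q'; rewrite inE => /predU1P[->|/lM].
        by apply: Isub qN; apply: leq_maxr.
      by apply: Isub; apply: leq_maxl.
    apply: (np M); apply: in_ideal_trans lM _; apply: contrapT => pl.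
    apply: (all_l (p M)); split=> //; exists M.+1; apply: in_ideal_mem.
    by apply: map_f; rewrite mem_iota /= add0n.
  have minl : exists h, [/\ I h, ~ in_ideal l h &
      forall h', I h' -> ~ in_ideal l h' -> (mpoly.mlead h <= mpoly.mlead h')%O].
    move: {2}(mpoly.mlead h0) (erefl (mpoly.mlead h0)) => m.
    elim/(@mpoly.ltmwf n) : m h0 Ih0 lh0 => m IH h Ih lh mh.
    have [hmin|] := pselect (forall h', I h' -> ~ in_ideal l h' ->
      (mpoly.mlead h <= mpoly.mlead h')%O); first by exists h.
    move=> /existsNP[h' /not_implyP[Ih' /not_implyP[lh' /negP]]].
    by rewrite -ltNge mh => hh'; apply: (IH _ hh' h').
  by have [h hP] := minl; exists h.
have [next nextP] := choice Inext.
have [q qE] := seq_rec_exists next.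
have qI k : I (q k).
  have [M kM] := ubnP k; elim: M => // M IH in k kM *.
  rewrite qE; apply: (fun H => let: And3 a _ _ := nextP _ H in a) => _ /mapP[i + ->].
  by rewrite mem_iota add0n => /= ik; apply: IH; apply: leq_trans ik _.
have qP k : [/\ I (q k), ~ in_ideal (mkseq q k) (q k) &
    forall h', I h' -> ~ in_ideal (mkseq q k) h' ->
      (mpoly.mlead (q k) <= mpoly.mlead h')%O].
  by rewrite qE; apply: nextP => _ /mapP[i _ ->].
have q0 k : q k != 0.
  by apply/eqP => qk; have [_ + _] := qP k; rewrite qk; apply; apply: in_ideal0.
have [i [j [ij dij]]] := dickson (fun k => mpoly.mlead (q k)).
have [w wP] := mlead_reduce (q0 i) (q0 j) dij.
have [[N qN] nqj minj] := qP j.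
have iq : in_ideal (mkseq q j) (w * q i).
  by apply/in_idealM/in_ideal_mem/map_f; rewrite mem_iota.
have nr : ~ in_ideal (mkseq q j) (q j - w * q i).
  by move=> H; apply: nqj; rewrite -(subrK (w * q i) (q j)); apply: in_idealD.
case: wP => [r0|rlt]; first by apply: nr; rewrite r0; apply: in_ideal0.
have [M qM] := qI i.
have /minj /(_ nr) : I (q j - w * q i).
  exists (maxn N M); apply: in_idealB.
    by apply: Isub qN; apply: leq_maxl.
  by apply: in_idealM; apply: Isub qM; apply: leq_maxr.
by rewrite leNgt rlt.
Qed.

(** Otherwise elements of [S] could be chosen one after another outside the ideal of their
    predecessors, against [hilbert_seq]. *)
Lemma hilbert_basis S :
  exists2 l, (forall h, h \in l -> S h) & forall h, S h -> in_ideal l h.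
Proof.
apply: contrapT => nS.
have Snext l : exists h, (forall q, q \in l -> S q) -> S h /\ ~ in_ideal l h.
  have [lS|] := pselect (forall q, q \in l -> S q); last by exists 0.
  apply: contrapT => /forallNP H; apply: nS; exists l => // h Sh.
  by apply: contrapT => lh; apply: (H h).
have [next nextP] := choice Snext; have [q qE] := seq_rec_exists next.
have qS k : S (q k).
  have [M kM] := ubnP k; elim: M => // M IH in k kM *.
  rewrite qE; apply: (fun H => (nextP _ H).1) => _ /mapP[i + ->].
  by rewrite mem_iota add0n => /= ik; apply: IH; apply: leq_trans ik _.
have [N] := hilbert_seq q.
by rewrite qE; apply: (nextP _ _).2 => _ /mapP[i _ ->].
Qed.

End Hilbert.

(** * Polynomial functions and charts *)

Section PolynomialFunctions.
Variables (R : realType) (n : nat).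
Local Notation poly := (rpoly R n).
Local Notation Xp j := (mpoly.mpolyX R (mpoly.mnm1 j) : rpoly R n).
Local Notation Cp c := (mpoly.mpolyC n c : rpoly R n).
Implicit Types (p q h d s : poly) (a x y : 'rV[R]_n).

Lemma pevalD p q x : peval (p + q) x = peval p x + peval q x.
Proof. exact: mpoly.mevalD. Qed.

Lemma pevalB p q x : peval (p - q) x = peval p x - peval q x.
Proof. exact: mpoly.mevalB. Qed.

Lemma pevalM p q x : peval (p * q) x = peval p x * peval q x.
Proof. exact: mpoly.mevalM. Qed.

Lemma peval0 x : peval (0 : poly) x = 0.
Proof. exact: mpoly.meval0. Qed.

Lemma peval1 x : peval (1 : poly) x = 1.
Proof. exact: mpoly.meval1. Qed.

Lemma pevalC c x : peval (Cp c) x = c.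
Proof. exact: mpoly.mevalC. Qed.

Lemma pevalX j x : peval (Xp j) x = x ord0 j.
Proof. exact: mpoly.mevalXU. Qed.

Lemma peval_sum (I : Type) (r : seq I) (P : pred I) (G : I -> poly) x :
  peval (\sum_(i <- r | P i) G i) x = \sum_(i <- r | P i) peval (G i) x.
Proof. exact: raddf_sum. Qed.

Lemma peval_prod (I : Type) (r : seq I) (P : pred I) (G : I -> poly) x :
  peval (\prod_(i <- r | P i) G i) x = \prod_(i <- r | P i) peval (G i) x.
Proof. exact: rmorph_prod. Qed.

Lemma peval_det m (A : 'M[poly]_m) x :
  peval (\det A) x = \det (\matrix_(i, j) peval (A i j) x).
Proof.
by rewrite /peval -det_map_mx; congr (\det _); apply/matrixP=> i j; rewrite !mxE.
Qed.

Lemma poly_ind (P : poly -> Prop) :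
  (forall c, P (Cp c)) -> (forall j, P (Xp j)) ->
  (forall p q, P p -> P q -> P (p + q)) -> (forall p q, P p -> P q -> P (p * q)) ->
  forall p, P p.
Proof.
move=> PC PX PD PM; elim/(@mpoly.mpolyind n R) => [|c m p _ _ Pp].
  by rewrite -mpoly.mpolyC0; apply: (PC).
apply: (PD) => //; rewrite -mpoly.mul_mpolyC; apply: (PM) => //.
rewrite mpoly.mpolyXE_id; elim/big_ind: _ => [|x y|i _].
- by rewrite -mpoly.mpolyC1; apply: (PC).
- exact: PM.
elim: (mpoly.fun_of_multinom m i) => [|k IH].
  by rewrite expr0 -mpoly.mpolyC1; apply: (PC).
by rewrite exprS; apply: PM.
Qed.

Lemma mderivXU i j : mpoly.mderiv i (Xp j) = (i == j)%:R.
Proof.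
rewrite mpoly.mderivX mpoly.mnm1E eq_sym; have [->|_] := eqVneq; last first.
  by rewrite scale0r.
have -> : mpoly.mnm_sub (mpoly.mnm1 j) (mpoly.mnm1 j) = mpoly.mnm0 :> mpoly.multinom n.
  by apply/mpoly.mnmP => k; rewrite mpoly.mnmBE mpoly.mnm0E subnn.
by rewrite mpoly.mpolyX0 scale1r.
Qed.

(** Hadamard's lemma. For products it follows from pq - p(a)q(a) = p (q - q(a)) + q(a) (p -
    p(a)). *)
Lemma taylor_factor h a : exists H : 'I_n -> poly,
  h - Cp (peval h a) = \sum_j H j * (Xp j - Cp (a ord0 j)) /\
  forall j, peval (H j) a = peval (mpoly.mderiv j h) a.
Proof.
elim/poly_ind: h => [c|j|p q [Hp [pE dp]] [Hq [qE dq]]|p q [Hp [pE dp]] [Hq [qE dq]]].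
- exists (fun=> 0); split=> [|j]; last by rewrite mpoly.mderivC.
  by rewrite pevalC subrr big1 // => j _; rewrite mul0r.
- exists (fun i => (i == j)%:R); split=> [|i]; last by rewrite mderivXU.
  rewrite (bigD1 j) //= eqxx mul1r pevalX big1 ?addr0 // => i /negPf ->.
  by rewrite mul0r.
- exists (fun j => Hp j + Hq j); split=> [|j]; last by rewrite mpoly.mderivD !pevalD dp dq.
  rewrite pevalD mpoly.mpolyCD opprD addrACA pE qE -big_split.
  by apply: eq_bigr => j _; rewrite mulrDl.
- exists (fun j => p * Hq j + Cp (peval q a) * Hp j); split=> [|j]; last first.
    by rewrite mpoly.mderivM !pevalD !pevalM pevalC dp dq addrC mulrC.
  rewrite pevalM mpoly.mpolyCM.
  transitivity (p * (q - Cp (peval q a)) + Cp (peval q a) * (p - Cp (peval p a))).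
    by ring.
  rewrite pE qE !mulr_sumr -big_split; apply: eq_bigr => j _.
  by rewrite mulrDl !mulrA.
Qed.

(** The Q_i are local coordinates centred at [a]. They are indexed by [nat], although only the first
    n count, so that initial segments Q_0, ..., Q_(k-1) can be formed without casts. *)
Definition chart_at (Q : nat -> poly) a :=
  (forall i, (i < n)%N -> peval (Q i) a = 0) /\
  Defs.jacobian (fun i : 'I_n => Q i) a \in unitmx.

(** The Q_i generate the maximal ideal of the local ring at [a]. Hadamard's lemma gives Q = A (X -
    a), where A(a) is the Jacobian matrix; multiplying by the adjugate of A puts det(A) (X - a) in
    the ideal of the Q_i. *)
Lemma chart_generates (Q : nat -> poly) a h :
  chart_at Q a -> peval h a = 0 ->
  exists d (e : nat -> poly), peval d a != 0 /\ d * h = \sum_(i < n) e i * Q i.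
Proof.
move=> [Qa Qu] ha.
have taylor0 p : peval p a = 0 -> exists H : 'I_n -> poly,
    p = \sum_j H j * (Xp j - Cp (a ord0 j)) /\
    forall j, peval (H j) a = peval (mpoly.mderiv j p) a.
  by move=> pa; have := taylor_factor p a; rewrite pa mpoly.mpolyC0 subr0.
have [H [hE _]] := taylor0 h ha.
have [M MP] := choice (fun i : 'I_n => taylor0 (Q i) (Qa i (ltn_ord i))).
pose A := (\matrix_(i, j) M i j)%R : 'M[poly]_n.
pose v := (\col_j (Xp j - Cp (a ord0 j)))%R : 'cV[poly]_n.
have Av : A *m v = \col_i Q i.
  apply/colP => i; rewrite !mxE {1}(MP i).1; apply: eq_bigr => j _.
  by rewrite !mxE.
have detv : \det A *: v = \adj A *m (\col_i Q i).
  by rewrite -Av mulmxA mul_adj_mx mul_scalar_mx.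
exists (\det A), (fun i => if insub i is Some k then ((\row_j H j) *m \adj A) 0 k else 0).
split.
  rewrite peval_det; suff -> : (\matrix_(i, j) peval (A i j) a)%R =
      Defs.jacobian (fun i : 'I_n => Q i) a by rewrite -unitfE -unitmxE.
  by apply/matrixP => i j; rewrite !mxE (MP i).2.
transitivity (((\row_j H j) *m (\adj A *m (\col_i Q i))) 0 0).
  rewrite -detv -scalemxAr !mxE; congr (_ * _); rewrite {1}hE.
  by apply: eq_bigr => j _; rewrite !mxE.
rewrite mulmxA !mxE; apply: eq_bigr => i _; rewrite valK; congr (_ * _).
by rewrite mxE.
Qed.

Definition poly_ideal (I : set poly) :=
  [/\ I 0, forall p q, I p -> I q -> I (p + q) & forall w p, I p -> I (w * p)].

Lemma poly_ideal_sum (I : set poly) (J : Type) (r : seq J) (P : pred J) (G : J -> poly) :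
  poly_ideal I -> (forall j, P j -> I (G j)) -> I (\sum_(j <- r | P j) G j).
Proof. by move=> [I0 ID _] IG; elim/big_ind : _. Qed.

(* The generators h of I satisfy N h = 0 modulo B for the matrix N = diag(d) - s A,
   whose determinant does not vanish at [a] because [s] does. *)
Lemma nakayama (I B : set poly) s a : poly_ideal I -> poly_ideal B -> peval s a = 0 ->
  (forall h, I h -> exists d h', [/\ peval d a != 0, I h' & B (d * h - s * h')]) ->
  forall h, I h -> exists2 d, peval d a != 0 & B (d * h).
Proof.
move=> idI idB sa IB; have [l lI Il] := hilbert_basis I.
have ex_d (i : 'I_(size l)) : exists d, peval d a != 0 /\
    exists A : nat -> poly, B (d * l`_i - s * \sum_(j < size l) A j * l`_j).
  have [d [h' [da /Il[A ->] dB]]] := IB l`_i (lI _ (mem_nth 0 (ltn_ord i))).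
  by exists d; split=> //; exists A.
have [d dP] := choice ex_d; have [A AP] := choice (fun i => (dP i).2).
pose N := (\matrix_(i, j) (d i *+ (i == j) - s * A i j))%R : 'M[poly]_(size l).
pose v := (\col_i l`_i)%R : 'cV[poly]_(size l).
have Nv i : B ((N *m v) i 0).
  suff -> : (N *m v) i 0 = d i * l`_i - s * \sum_(j < size l) A i j * l`_j by [].
  rewrite mxE mulr_sumr.
  under eq_bigr => j _ do rewrite !mxE mulrBl.
  rewrite big_split /= sumrN; congr (_ - _).
    by rewrite (bigD1 i) //= eqxx mulr1n big1 ?addr0 // => j /negPf ji;
      rewrite eq_sym ji mulr0n mul0r.
  by apply: eq_bigr => j _; rewrite mulrA.
have detN (i : 'I_(size l)) : B (\det N * l`_i).
  suff -> : \det N * l`_i = (\adj N *m (N *m v)) i 0.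
    rewrite mxE; apply: poly_ideal_sum => // k _.
    by case: idB => _ _; apply.
  by rewrite mulmxA mul_adj_mx mul_scalar_mx !mxE.
move=> h /Il[b ->]; exists (\det N).
  rewrite peval_det; suff -> : (\matrix_(i, j) peval (N i j) a)%R =
      diag_mx (\row_i peval (d i) a).
    by rewrite det_diag prodf_seq_neq0; apply/allP => i _; rewrite mxE (dP i).1.
  apply/matrixP => i j; rewrite !mxE pevalB pevalM sa mul0r subr0.
  by case: eqP => _; rewrite ?mulr1n ?mulr0n ?peval0.
rewrite mulr_sumr; apply: poly_ideal_sum => // i _; rewrite mulrCA.
by case: idB => _ _; apply.
Qed.

End PolynomialFunctions.

(* Makes ['M[R]_(m, n)] a [completeNormedModType], for Banach's fixed point theorem. *)
HB.instance Definition _ (R : realType) (m n : nat) := Complete.on 'M[R]_(m, n).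

(** * Norm estimates and Taylor's formula for polynomial maps *)

Section Analysis.
Variables (R : realType) (n : nat).
Local Notation poly := (rpoly R n).
Local Notation Xp j := (mpoly.mpolyX R (mpoly.mnm1 j) : rpoly R n).
Local Notation Cp c := (mpoly.mpolyC n c : rpoly R n).
Implicit Types (p q h d : poly) (a x y w : 'rV[R]_n).

Lemma ler_coord_norm m1 m2 (A : 'M[R]_(m1, m2)) i j : `|A i j| <= `|A|.
Proof.
by rewrite [leRHS]/Num.Def.normr /= mx_normrE; apply: (le_bigmax 0 _ (i, j)).
Qed.

Lemma ler_norm_coord m1 m2 (A : 'M[R]_(m1, m2)) (M : R) :
  0 <= M -> (forall i j, `|A i j| <= M) -> `|A| <= M.
Proof.
by move=> M0 AM; rewrite [leLHS]/Num.Def.normr /= mx_normrE; apply: bigmax_le.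
Qed.

Lemma ler_norm_mulmx m1 m2 m3 (A : 'M[R]_(m1, m2)) (B : 'M[R]_(m2, m3)) :
  `|A *m B| <= m2%:R * `|A| * `|B|.
Proof.
apply: ler_norm_coord => [|i j]; first by rewrite !mulr_ge0.
rewrite mxE; apply: le_trans (ler_norm_sum _ _ _) _.
rewrite -mulrA mulr_natl -[X in _ *+ X]card_ord -sumr_const.
by apply: ler_sum => k _; rewrite normrM ler_pM // ler_coord_norm.
Qed.

Lemma nbhs_normE x (W : set 'rV[R]_n) :
  nbhs x W <-> exists2 e : R, 0 < e & forall y, `|y - x| < e -> W y.
Proof.
split=> [/nbhs_ballP[e /= e0 eW]|[e e0 eW]].
  by exists e => // y yx; apply: eW; rewrite -ball_normE /ball_ /= distrC.
apply/nbhs_ballP; exists e => //= y; rewrite -ball_normE /ball_ /= distrC.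
exact: eW.
Qed.

Lemma peval_continuous p : continuous (peval p).
Proof.
elim/poly_ind: p => [c|j|p q cp cq|p q cp cq] x.
- have -> : peval (Cp c) = fun=> c by apply/funext => y; rewrite pevalC.
  exact: cst_continuous.
- have -> : peval (Xp j) = fun y => y ord0 j by apply/funext => y; rewrite pevalX.
  exact: coord_continuous.
- have -> : peval (p + q) = fun y => peval p y + peval q y.
    by apply/funext => y; rewrite pevalD.
  exact: (cvgD (cp x) (cq x)).
- have -> : peval (p * q) = fun y => peval p y * peval q y.
    by apply/funext => y; rewrite pevalM.
  exact: (cvgM (cp x) (cq x)).
Qed.

Lemma peval_bounded p (r : R) :
  exists2 K : R, 0 <= K & forall x, `|x| <= r -> `|peval p x| <= K.
Proof.
elim/poly_ind: p => [c|j|p q [K K0 pK] [L L0 qL]|p q [K K0 pK] [L L0 qL]].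
- by exists `|c| => // x _; rewrite pevalC.
- exists `|r| => // x xr; rewrite pevalX.
  by apply: le_trans (ler_coord_norm _ _ _) (le_trans xr (ler_norm _)).
- exists (K + L); first exact: addr_ge0.
  move=> x xr; rewrite pevalD; apply: le_trans (ler_normD _ _) _.
  by apply: lerD; [apply: pK | apply: qL].
- exists (K * L); first exact: mulr_ge0.
  by move=> x xr; rewrite pevalM normrM; apply: ler_pM => //; [apply: pK | apply: qL].
Qed.

Lemma peval_lipschitz p (r : R) : exists2 K : R, 0 <= K &
  forall x y, `|x| <= r -> `|y| <= r -> `|peval p y - peval p x| <= K * `|y - x|.
Proof.
elim/poly_ind: p => [c|j|p q [K K0 pK] [L L0 qL]|p q [K K0 pK] [L L0 qL]].
- by exists 0 => // x y _ _; rewrite !pevalC subrr normr0 mul0r.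
- exists 1 => // x y _ _; rewrite !pevalX mul1r.
  by have := ler_coord_norm (y - x) ord0 j; rewrite !mxE.
- exists (K + L); first exact: addr_ge0.
  move=> x y xr yr; rewrite !pevalD opprD addrACA mulrDl.
  apply: le_trans (ler_normD _ _) _.
  by apply: lerD; [apply: pK | apply: qL].
- have [K' K'0 pK'] := peval_bounded p r; have [L' L'0 qL'] := peval_bounded q r.
  exists (K' * L + L' * K); first by rewrite addr_ge0 // mulr_ge0.
  move=> x y xr yr; rewrite !pevalM.
  have -> : peval p y * peval q y - peval p x * peval q x =
    peval p y * (peval q y - peval q x) + peval q x * (peval p y - peval p x) by ring.
  apply: le_trans (ler_normD _ _) _; rewrite !normrM mulrDl -!mulrA.
  by apply: lerD; apply: ler_pM => //; [apply: pK' | apply: qL | apply: qL' | apply: pK].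
Qed.

Definition linear_part h x y : R := \sum_j peval (mpoly.mderiv j h) x * (y - x) ord0 j.

Lemma peval_taylor p (r : R) : exists2 K : R, 0 <= K &
  forall x y, `|x| <= r -> `|y| <= r ->
    `|peval p y - peval p x - linear_part p x y| <= K * `|y - x| ^+ 2.
Proof.
elim/poly_ind: p => [c|j|p q [K K0 pK] [L L0 qL]|p q [K K0 pK] [L L0 qL]].
- exists 0 => // x y _ _; rewrite !pevalC subrr /linear_part big1 ?subrr ?normr0 ?mul0r //.
  by move=> j _; rewrite mpoly.mderivC peval0 mul0r.
- exists 0 => // x y _ _; rewrite !pevalX /linear_part (bigD1 j) //= big1.
    by rewrite mderivXU eqxx peval1 mul1r addr0 !mxE subrr normr0 mul0r.
  by move=> i /negPf ij; rewrite mderivXU ij peval0 mul0r.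
- exists (K + L); first exact: addr_ge0.
  move=> x y xr yr; have -> : linear_part (p + q) x y = linear_part p x y + linear_part q x y.
    rewrite /linear_part -big_split; apply: eq_bigr => j _ /=.
    by rewrite mpoly.mderivD pevalD mulrDl.
  rewrite !pevalD mulrDl.
  have -> : peval p y + peval q y - (peval p x + peval q x) -
      (linear_part p x y + linear_part q x y) =
    (peval p y - peval p x - linear_part p x y) +
    (peval q y - peval q x - linear_part q x y) by ring.
  apply: le_trans (ler_normD _ _) _.
  by apply: lerD; [apply: pK | apply: qL].
- have [Kb Kb0 pKb] := peval_bounded p r; have [Lb Lb0 qLb] := peval_bounded q r.
  have [Kl Kl0 pKl] := peval_lipschitz p r; have [Ll Ll0 qLl] := peval_lipschitz q r.
  exists (Lb * K + Kb * L + Kl * Ll); first by rewrite !addr_ge0 // mulr_ge0.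
  move=> x y xr yr.
  have -> : linear_part (p * q) x y =
      peval q x * linear_part p x y + peval p x * linear_part q x y.
    rewrite /linear_part !mulr_sumr -big_split; apply: eq_bigr => j _ /=.
    by rewrite mpoly.mderivM pevalD !pevalM; ring.
  rewrite !pevalM.
  have -> : peval p y * peval q y - peval p x * peval q x -
      (peval q x * linear_part p x y + peval p x * linear_part q x y) =
    peval q x * (peval p y - peval p x - linear_part p x y) +
    peval p x * (peval q y - peval q x - linear_part q x y) +
    (peval p y - peval p x) * (peval q y - peval q x) by ring.
  apply: le_trans (ler_normD _ _) _; rewrite [leRHS]mulrDl; apply: lerD.
    apply: le_trans (ler_normD _ _) _; rewrite [leRHS]mulrDl !normrM -!mulrA.
    by apply: lerD; apply: ler_pM => //; [apply: qLb | apply: pK | apply: pKb | apply: qL].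
  rewrite normrM expr2 mulrACA.
  by apply: ler_pM => //; [apply: pKl | apply: qLl].
Qed.

Lemma uniform_bound (I : finType) (P : I -> R -> Prop) :
  (forall i K L, K <= L -> P i K -> P i L) ->
  (forall i, exists2 K : R, 0 <= K & P i K) -> exists2 K : R, 0 <= K & forall i, P i K.
Proof.
move=> Pmono Pex; have [K KP] := choice (fun i => let: ex_intro2 K a b := Pex i in
  ex_intro (fun K => 0 <= K /\ P i K) K (conj a b)).
exists (\sum_i K i); first by apply: sumr_ge0 => i _; case: (KP i).
move=> i; apply: Pmono (KP i).2; rewrite (bigD1 i) //= lerDl.
by apply: sumr_ge0 => j _; case: (KP j).
Qed.

Definition poly_map (Q : nat -> poly) x : 'rV[R]_n := \row_(i < n) peval (Q i) x.

Definition jac (Q : nat -> poly) x : 'M[R]_n := Defs.jacobian (fun i : 'I_n => Q i) x.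

Lemma jac_lipschitz Q (r : R) : exists2 K : R, 0 <= K & forall x y,
  `|x| <= r -> `|y| <= r -> `|jac Q y - jac Q x| <= K * `|y - x|.
Proof.
have entry (ij : 'I_n * 'I_n) : exists2 K : R, 0 <= K & forall x y,
    `|x| <= r -> `|y| <= r -> `|(jac Q y - jac Q x) ij.1 ij.2| <= K * `|y - x|.
  have [K K0 KP] := peval_lipschitz (mpoly.mderiv ij.2 (Q ij.1)) r.
  by exists K => // x y xr yr; rewrite !mxE; apply: KP.
have mono := fun (ij : 'I_n * 'I_n) (K L : R) (KL : K <= L) (H : forall x y,
    `|x| <= r -> `|y| <= r -> `|(jac Q y - jac Q x) ij.1 ij.2| <= K * `|y - x|)
  x y xr yr => le_trans (H x y xr yr) (ler_wpM2r (normr_ge0 _) KL).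
have [K K0 KP] := uniform_bound mono entry.
exists K => // x y xr yr; apply: ler_norm_coord; first exact: mulr_ge0.
by move=> i j; apply: (KP (i, j)).
Qed.

Lemma poly_map_taylor Q (r : R) : exists2 K : R, 0 <= K & forall x y,
  `|x| <= r -> `|y| <= r ->
  `|poly_map Q y - poly_map Q x - (y - x) *m (jac Q x)^T| <= K * `|y - x| ^+ 2.
Proof.
have mono := fun (i : 'I_n) (K L : R) (KL : K <= L) (H : forall x y,
    `|x| <= r -> `|y| <= r ->
    `|peval (Q i) y - peval (Q i) x - linear_part (Q i) x y| <= K * `|y - x| ^+ 2)
  x y xr yr => le_trans (H x y xr yr) (ler_wpM2r (exprn_ge0 2 (normr_ge0 _)) KL).
have [K K0 KP] := uniform_bound mono (fun i => peval_taylor (Q i) r).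
exists K => // x y xr yr; apply: ler_norm_coord; first by rewrite mulr_ge0 // exprn_ge0.
move=> i0 i; rewrite !mxE; have := KP i x y xr yr; rewrite /linear_part.
rewrite [X in _ - X](_ : _ = \sum_j (y - x) i0 j * (jac Q x)^T j i) //.
by apply: eq_bigr => j _; rewrite (ord1 i0) !mxE mulrC.
Qed.

End Analysis.

(** * The inverse function theorem for polynomial maps *)

Section InverseFunction.
Variables (R : realType) (n : nat).
Local Notation poly := (rpoly R n).
Implicit Types (p q h d : poly) (a x y v : 'rV[R]_n) (Q : nat -> poly).

Lemma norm_trmx_le m1 m2 (A : 'M[R]_(m1, m2)) : `|A^T| <= `|A|.
Proof. by apply: ler_norm_coord => // i j; rewrite mxE; apply: ler_coord_norm. Qed.

Lemma fixed_point_ball a (r : R) (T : 'rV[R]_n -> 'rV[R]_n) :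
  0 < r -> (forall x, `|x - a| <= r -> `|T x - a| <= r) ->
  (forall x y, `|x - a| <= r -> `|y - a| <= r -> `|T x - T y| <= 2^-1 * `|x - y|) ->
  exists2 y, `|y - a| <= r & y = T y.
Proof.
move=> r0 Tball Tcontr; pose U := closed_ball a r.
have UE x : U x <-> `|x - a| <= r by rewrite /U closed_ballE // /closed_ball_ /= distrC.
have TU : {homo T : x / U x >-> U x} by move=> x /UE/Tball/UE.
have [|||y /UE ya yT] := @banach_fixed_point R 'rV[R]_n U (mkfun TU); last by exists y.
- exists (2^-1)%:nng; split; first by rewrite /=; lra.
  by move=> [x y] /= [/UE xr /UE yr]; apply: Tcontr.
- exact: closed_ball_closed.
- by exists a; apply/UE; rewrite subrr normr0 ltW.
Qed.

(** Newton iteration with the derivative frozen at [a]: for every [v], the map [T v] sending y to y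
    - (Q(y) - v) B halves distances near [a]. Its fixed points solve Q(y) = v, and the contraction
    estimate also yields the Lipschitz bound for the local inverse. *)
Lemma inverse_function Q a : jac Q a \in unitmx ->
  exists r K : R, [/\ 0 < r, 0 < K,
    forall x y, `|x - a| <= r -> `|y - a| <= r ->
      `|y - x| <= K * `|poly_map Q y - poly_map Q x| &
    forall v, K * `|v - poly_map Q a| <= r ->
      exists2 y, `|y - a| <= K * `|v - poly_map Q a| & poly_map Q y = v].
Proof.
move=> Ju; set J := jac Q a in Ju; pose B := invmx J^T.
have JB u : u *m J^T *m B = u :> 'rV_n.
  by rewrite -mulmxA mulmxV ?mulmx1 // unitmx_tr.
pose b := n%:R * `|B|; have b0 : 0 <= b by rewrite mulr_ge0.
have [K2 K20 taylorQ] := poly_map_taylor Q (`|a| + 1).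
have [L L0 lipJ] := jac_lipschitz Q (`|a| + 1).
pose M := b * (2 * K2 + n%:R * L).
have M0 : 0 <= M by rewrite mulr_ge0 // addr_ge0 // mulr_ge0.
(* This radius makes [r * M] at most 1/2, and [r <= 1] keeps the ball inside the region where the
   constants [K2] and [L] are valid. *)
pose r := (2 * (M + 1))^-1.
have r0 : 0 < r by rewrite invr_gt0; lra.
have rM : r * M <= 2^-1.
  rewrite /r mulrC ler_pdivrMr; lra.
have r1 : r <= 1 by rewrite /r invf_le1; lra.
pose T v y := y - (poly_map Q y - v) *m B.
have ball1 x : `|x - a| <= r -> `|x| <= `|a| + 1.
  move=> xa; have -> : x = a + (x - a) by rewrite addrC subrK.
  by apply: le_trans (ler_normD _ _) _; rewrite lerD2l (le_trans xa).
have Tcontr v x y : `|x - a| <= r -> `|y - a| <= r ->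
    `|T v x - T v y| <= 2^-1 * `|x - y|.
  move=> ya xa.
  have -> : T v x - T v y = - ((poly_map Q x - poly_map Q y - (x - y) *m (jac Q y)^T) +
      (x - y) *m (jac Q y - J)^T) *m B.
    rewrite [(jac Q y - J)^T]linearB /= mulmxBr addrA subrK mulNmx mulmxBl JB /T.
    by rewrite !mulmxBl; apply/rowP => i; rewrite !mxE; ring.
  apply: le_trans (ler_norm_mulmx _ _) _; rewrite normrN mulrAC -/b.
  have xy2 : `|x - y| <= 2 * r.
    have -> : x - y = (x - a) - (y - a) by rewrite opprB addrA subrK.
    by apply: le_trans (ler_normB _ _) _; lra.
  have H1 : `|poly_map Q x - poly_map Q y - (x - y) *m (jac Q y)^T| <=
      2 * K2 * r * `|x - y|.
    apply: le_trans (taylorQ _ _ (ball1 _ xa) (ball1 _ ya)) _.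
    by rewrite expr2 mulrA ler_wpM2r // -mulrA mulrCA ler_wpM2l // mulrC.
  have H2 : `|(x - y) *m (jac Q y - J)^T| <= n%:R * L * r * `|x - y|.
    apply: le_trans (ler_norm_mulmx _ _) _.
    rewrite mulrAC ler_wpM2r // -mulrA ler_wpM2l //.
    apply: le_trans (norm_trmx_le _) _.
    have aa : `|a| <= `|a| + 1 by rewrite lerDl.
    by apply: le_trans (lipJ _ _ aa (ball1 _ xa)) _; rewrite ler_wpM2l.
  apply: (@le_trans _ _ (b * (2 * K2 * r * `|x - y| + n%:R * L * r * `|x - y|))).
    by rewrite ler_wpM2l //; apply: le_trans (ler_normD _ _) _; apply: lerD.
  have -> : b * (2 * K2 * r * `|x - y| + n%:R * L * r * `|x - y|) = r * M * `|x - y|.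
    by rewrite /M; ring.
  by rewrite ler_wpM2r.
(* The contraction gives |y - x| <= |y - x| / 2 + b |Q(y) - Q(x)|, hence the factor 2b; adding 1 to
   [b] makes [K] positive. *)
pose K := 2 * (b + 1).
have inj x y : `|x - a| <= r -> `|y - a| <= r ->
    `|y - x| <= K * `|poly_map Q y - poly_map Q x|.
  move=> xa ya; have := Tcontr 0 y x ya xa.
  have H : `|(poly_map Q y - poly_map Q x) *m B| <= b * `|poly_map Q y - poly_map Q x|.
    by apply: le_trans (ler_norm_mulmx _ _) _; rewrite mulrAC.
  have E : y - x = (T 0 y - T 0 x) + (poly_map Q y - poly_map Q x) *m B.
    by rewrite /T !subr0 mulmxBl; apply/rowP => i; rewrite !mxE; ring.
  have := ler_normD (T 0 y - T 0 x) ((poly_map Q y - poly_map Q x) *m B).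
  rewrite -E => E1 E2.
  have : `|poly_map Q y - poly_map Q x| >= 0 by [].
  rewrite /K; set t := `|poly_map Q y - poly_map Q x| in H *; set s := `|y - x| in E1 E2 *.
  by move=> t0; lra.
exists r, K; split=> //; first by rewrite /K; lra.
move=> v va; have [|x xa|y ya yT] := @fixed_point_ball a r (T v) r0.
- move=> x xa; have -> : T v x - a = (T v x - T v a) + (T v a - a) by rewrite addrA subrK.
  apply: le_trans (ler_normD _ _) _.
  have := Tcontr v x a xa; rewrite subrr normr0 => /(_ (ltW r0)) H.
  have : `|T v a - a| <= b * `|v - poly_map Q a|.
    rewrite /T addrAC subrr add0r -mulNmx opprB.
    by apply: le_trans (ler_norm_mulmx _ _) _; rewrite mulrAC.
  have := normr_ge0 (v - poly_map Q a); move: va; rewrite /K; lra.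
- exact: Tcontr.
have Qy : poly_map Q y = v.
  move/eqP: yT; rewrite /T eq_sym subr_eq addrC -subr_eq subrr eq_sym => /eqP H.
  have := mulmxA (poly_map Q y - v) B J^T.
  by rewrite H mul0mx mulVmx ?unitmx_tr // mulmx1 => /eqP; rewrite subr_eq0 => /eqP.
exists y => //; rewrite -Qy; apply: inj => //.
by rewrite subrr normr0 ltW.
Qed.

Definition det_jac Q : poly := \det (\matrix_(i < n, j < n) mpoly.mderiv j (Q i)).

Lemma peval_det_jac Q x : peval (det_jac Q) x = \det (jac Q x).
Proof. by rewrite peval_det; congr (\det _); apply/matrixP => i j; rewrite !mxE. Qed.

Lemma jac_unit_det Q x : (jac Q x \in unitmx) = (peval (det_jac Q) x != 0).
Proof. by rewrite unitmxE unitfE peval_det_jac. Qed.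

Lemma near_peval_neq0 p a : peval p a != 0 -> \forall x \near a, peval p x != 0.
Proof. exact: (@cvgr_neq0 _ _ _ _ _ _ _ (@peval_continuous R n p a)). Qed.

(** Moves [x] along the k-th coordinate line of the chart: local surjectivity solves Q(y) = Q(x) + t
    e_k, with t so small that y stays in [W]. *)
Lemma chart_perturb Q x k (W : set 'rV[R]_n) : jac Q x \in unitmx -> nbhs x W ->
  (k < n)%N -> exists y, [/\ W y, peval (Q k) y != peval (Q k) x &
    forall i, (i < n)%N -> i != k -> peval (Q i) y = peval (Q i) x].
Proof.
move=> Ju /nbhs_normE[e e0 eW] kn.
have [r [K [r0 K0 _ surj]]] := inverse_function Ju.
pose t := Num.min r (e / 2) / K.
have m0 : 0 < Num.min r (e / 2) by rewrite lt_min r0 divr_gt0.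
have t0 : 0 < t by rewrite divr_gt0.
pose v := poly_map Q x + t *: delta_mx 0 (Ordinal kn).
have vx : `|v - poly_map Q x| <= t.
  rewrite /v addrAC subrr add0r; apply: ler_norm_coord; first exact: ltW.
  move=> i j; rewrite !mxE; case: andP => _; last by rewrite mulr0 normr0 ltW.
  by rewrite mulr1 gtr0_norm.
have Kv : K * `|v - poly_map Q x| <= Num.min r (e / 2).
  by rewrite -ler_pdivlMl // mulrC.
have [|y yx yv] := surj v; first by apply: le_trans Kv _; rewrite ge_min lexx.
have Qy i (ik : (i < n)%N) :
    peval (Q i) y = peval (Q i) x + t * (i == k)%:R.
  by have := congr1 (fun u : 'rV_n => u 0 (Ordinal ik)) yv; rewrite !mxE eqxx /= => ->.
exists y; split.
- apply: eW; apply: le_lt_trans yx (le_lt_trans Kv _).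
  by rewrite gt_min; apply/orP; right; lra.
- by rewrite Qy // eqxx mulr1 -subr_eq0 addrAC subrr add0r gt_eqF.
- by move=> i ik /negPf ki; rewrite Qy // ki mulr0 addr0.
Qed.

End InverseFunction.

(** * Ideals of germs in a chart *)

Section ChartIdeals.
Variables (R : realType) (n : nat).
Local Notation poly := (rpoly R n).
Implicit Types (p q h d : poly) (a x y v : 'rV[R]_n) (Q : nat -> poly) (I : set poly).

(* Downward induction on k: by the case k + 1, a germ h vanishing on the locus
   Q_0 = ... = Q_(k-1) = 0 equals Q_k e modulo Q_0, ..., Q_(k-1), and e vanishes on
   that locus off Q_k = 0, hence on all of it by continuity.  Nakayama's lemma then
   applies with s = Q_k. *)
Lemma germ_ideal_generates Q a k (W : set 'rV[R]_n) h :
  chart_at Q a -> (k <= n)%N -> nbhs a W ->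
  (forall x, W x -> (forall i, (i < k)%N -> peval (Q i) x = 0) -> peval h x = 0) ->
  exists d (e : nat -> poly), peval d a != 0 /\ d * h = \sum_(i < k) e i * Q i.
Proof.
move=> Qa kn; rewrite -(subKn kn); have := leq_subr k n.
elim: (n - k)%N h W => [|m IH] h W mn Wa hW.
  rewrite subn0 in hW *; apply: chart_generates => //; apply: hW => [|i im].
    exact: nbhs_singleton.
  exact: Qa.1.
set l := (n - m.+1)%N in hW *; have lS : (n - m)%N = l.+1 by rewrite /l; lia.
have ln : (l < n)%N by rewrite /l; lia.
pose I g := exists2 V, nbhs a V &
  forall x, V x -> (forall i, (i < l)%N -> peval (Q i) x = 0) -> peval g x = 0.
pose B g := exists e : nat -> poly, g = \sum_(i < l) e i * Q i.
have idI : poly_ideal I.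
  split=> [|p q [V Va pV] [V' V'a qV]|w p [V Va pV]].
  - by exists setT => [|x _ _]; [apply: filterT | rewrite peval0].
  - exists (V `&` V'); first exact: filterI.
    by move=> x [Vx V'x] Qx; rewrite pevalD pV ?qV ?addr0.
  - by exists V => // x Vx Qx; rewrite pevalM pV ?mulr0.
have idB : poly_ideal B.
  split=> [|p q [e ->] [e' ->]|w p [e ->]].
  - by exists (fun=> 0); rewrite big1 // => i _; rewrite mul0r.
  - exists (e \+ e'); rewrite -big_split; apply: eq_bigr => i _.
    by rewrite mulrDl.
  - exists (fun i => w * e i); rewrite mulr_sumr; apply: eq_bigr => i _.
    by rewrite mulrA.
have IB g : I g -> exists d g', [/\ peval d a != 0, I g' & B (d * g - Q l * g')].
  move=> [V Va gV]; have [x Vx Qx|d [e [da dg]]] := IH g V (ltnW mn) Va.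
    by apply: gV => // i il; apply: Qx; rewrite lS ltnS ltnW.
  rewrite lS big_ord_recr /= in dg; exists d, (e l); split=> //; last first.
    by exists e; rewrite dg [Q l * _]mulrC addrK.
  exists (V° `&` [set x | jac Q x \in unitmx]).
    apply: filterI; first exact: nbhs_interior.
    have : peval (det_jac Q) a != 0 by rewrite -jac_unit_det Qa.2.
    by move/near_peval_neq0; apply: filterS => x /=; rewrite jac_unit_det.
  move=> x [Vx /= Jx] Qx; apply: contrapT => /eqP ex.
  have eQ y : V y -> (forall i, (i < l)%N -> peval (Q i) y = 0) ->
      peval (e l) y * peval (Q l) y = 0.
    move=> Vy Qy; have := congr1 (fun p => peval p y) dg.
    rewrite pevalM (gV y Vy Qy) mulr0 pevalD peval_sum big1 ?add0r; last first.
      by move=> i _; rewrite pevalM Qy ?mulr0.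
    by rewrite pevalM.
  have /eqP := eQ x (nbhs_singleton Vx) Qx.
  rewrite mulf_eq0 (negPf ex) /= => /eqP Qlx.
  have [y [[Vy ey] Qly Qy]] := chart_perturb Jx (filterI Vx (near_peval_neq0 ex)) ln.
  have Qy0 i : (i < l)%N -> peval (Q i) y = 0.
    by move=> il; rewrite Qy ?Qx // ?neq_ltn ?il // (ltn_trans il).
  rewrite Qlx in Qly; have /eqP := eQ y Vy Qy0.
  by rewrite mulf_eq0 (negPf ey) (negPf Qly).
have Ql0 : peval (Q l) a = 0 by apply: Qa.1.
have [|d da [e dh]] := nakayama idI idB Ql0 IB (h := h); first by exists W.
by exists d, e.
Qed.

(** Since L <= 1/2, the bound e_i <= 2 i D / N^2 propagates: the linear term contributes at most D /
    N^2 per step, as does the error term. *)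
Lemma discrete_gronwall (e : nat -> R) (N : nat) (L D : R) :
  (0 < N)%N -> e 0%N = 0 -> 0 <= L <= 2^-1 -> 0 <= D ->
  (forall i, (i < N)%N -> e i.+1 <= e i + L / N%:R * e i + D / N%:R ^+ 2) ->
  e N <= 2 * D / N%:R.
Proof.
move=> N0 e0 /andP[L0 L2] D0 estep; have NR0 : 0 < N%:R :> R by rewrite ltr0n.
have H i : (i <= N)%N -> e i <= 2 * i%:R * (D / N%:R ^+ 2).
  elim: i => [|i IH] iN; first by rewrite e0 mulr0 mul0r.
  apply: le_trans (estep i iN) _; have := IH (ltnW iN).
  set t := D / N%:R ^+ 2; have t0 : 0 <= t by rewrite /t divr_ge0 // exprn_ge0.
  move=> ei; have LN0 : 0 <= L / N%:R by rewrite divr_ge0.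
  have : L / N%:R * e i <= L / N%:R * (2 * i%:R * t) by rewrite ler_wpM2l.
  have : L / N%:R * (2 * i%:R * t) <= t.
    have -> : L / N%:R * (2 * i%:R * t) = (2 * L) * (i%:R / N%:R) * t by field; lra.
    have iN0 : 0 <= i%:R / N%:R :> R by rewrite divr_ge0.
    have iN1 : i%:R / N%:R <= 1 :> R by rewrite ler_pdivrMr // mul1r ler_nat ltnW.
    by rewrite -[leRHS]mul1r ler_wpM2r // mulr_ile1 //; lra.
  rewrite -natr1; lra.
apply: le_trans (H N (leqnn N)) _; rewrite le_eqVlt; apply/orP; left.
by apply/eqP; field; lra.
Qed.

(* [chart_deriv Q h l] is det(J_Q) times the derivative of h with respect to the
   l-th coordinate of the chart Q. *)
Definition chart_deriv Q h (l : 'I_n) : poly :=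
  ((\row_j mpoly.mderiv j h) *m \adj (\matrix_(i < n, j < n) mpoly.mderiv j (Q i))) 0 l.

Lemma chart_derivE Q h j :
  det_jac Q * mpoly.mderiv j h = \sum_(l < n) chart_deriv Q h l * mpoly.mderiv j (Q l).
Proof.
set J := (\matrix_(i < n, j < n) mpoly.mderiv j (Q i) : 'M[poly]_n)%R.
have := mulmxA (\row_j mpoly.mderiv j h) (\adj J) J.
rewrite mul_adj_mx mul_mx_scalar => /rowP/(_ j); rewrite !mxE => ->.
by apply: eq_bigr => l _; rewrite [J l j]mxE.
Qed.

Lemma chart_deriv_linear_part Q h x y :
  peval (det_jac Q) x * linear_part h x y =
  \sum_(l < n) peval (chart_deriv Q h l) x * linear_part (Q l) x y.
Proof.
rewrite /linear_part mulr_sumr.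
under [RHS]eq_bigr => l _ do rewrite mulr_sumr.
rewrite exchange_big; apply: eq_bigr => j _ /=.
rewrite mulrA -pevalM chart_derivE peval_sum mulr_suml; apply: eq_bigr => l _.
by rewrite pevalM mulrA.
Qed.

Definition abs_sum (l : seq poly) x : R := \sum_(j < size l) `|peval l`_j x|.

Lemma in_ideal_abs_sum (l : seq poly) h (r : R) : in_ideal l h ->
  exists2 K : R, 0 <= K & forall x, `|x| <= r -> `|peval h x| <= K * abs_sum l x.
Proof.
move=> [c ->].
have mono := fun (i : 'I_(size l)) (K L : R) (KL : K <= L)
  (H : forall x, `|x| <= r -> `|peval (c i) x| <= K) x xr => le_trans (H x xr) KL.
have [K K0 KP] := uniform_bound mono (fun i => peval_bounded (c i) r).
exists K => // x xr; rewrite peval_sum mulr_sumr.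
apply: le_trans (ler_norm_sum _ _ _) _; apply: ler_sum => i _.
by rewrite pevalM normrM ler_wpM2r // KP.
Qed.

(** A step of length [u] in chart coordinates inside the locus Q_0 = ... = Q_(k-1) = 0. The first k
    coordinates do not change, the derivatives in the other directions belong to the ideal and are
    O([abs_sum l x]), and the Taylor remainder is O(u^2). *)
Lemma chart_step (l : seq poly) Q a k : chart_at Q a ->
  (forall h (i : 'I_n), h \in l -> (k <= i)%N -> in_ideal l (chart_deriv Q h i)) ->
  exists r C : R, [/\ 0 < r, 0 <= C & forall x y, `|x - a| <= r -> `|y - a| <= r ->
    (forall i, (i < k)%N -> peval (Q i) x = 0) -> (forall i, (i < k)%N -> peval (Q i) y = 0) ->
    forall u : R, u = `|poly_map Q y - poly_map Q x| ->
    abs_sum l y <= abs_sum l x + C * u * abs_sum l x + C * u ^+ 2].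
Proof.
move=> [Qa Ju] lder.
have [r1 [K [r10 K0 inj _]]] := inverse_function Ju.
have da : peval (det_jac Q) a != 0 by rewrite -jac_unit_det.
pose dl := `|peval (det_jac Q) a| / 2; have dl0 : 0 < dl by rewrite /dl divr_gt0 // normr_gt0.
have [r2 r20 dP] : exists2 r2 : R, 0 < r2 & forall x, `|x - a| < r2 -> dl <= `|peval (det_jac Q) x|.
  apply/(nbhs_normE a (fun x => dl <= `|peval (det_jac Q) x|)).
  have := @cvgr_dist_lt _ _ _ _ (nbhs_filter a) _ _ (@peval_continuous R n (det_jac Q) a) _ dl0.
  apply: filterS => x /=.
  have := ler_normD (peval (det_jac Q) a - peval (det_jac Q) x) (peval (det_jac Q) x).
  by rewrite subrK /dl => H1 H2; lra.
pose r := Num.min r1 (r2 / 2); have r0 : 0 < r by rewrite lt_min r10 divr_gt0.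
pose rr := `|a| + r.
have ballr x : `|x - a| <= r -> `|x| <= rr.
  move=> xa; have -> : x = a + (x - a) by rewrite addrC subrK.
  by apply: le_trans (ler_normD _ _) _; rewrite lerD2l.
have [T T0 TP] : exists2 T : R, 0 <= T & forall j : 'I_(size l), forall x y,
    `|x| <= rr -> `|y| <= rr ->
    `|peval l`_j y - peval l`_j x - linear_part l`_j x y| <= T * `|y - x| ^+ 2.
  have mono := fun (j : 'I_(size l)) (K L : R) (KL : K <= L) (H : forall x y,
    `|x| <= rr -> `|y| <= rr ->
    `|peval l`_j y - peval l`_j x - linear_part l`_j x y| <= K * `|y - x| ^+ 2)
    x y xr yr => le_trans (H x y xr yr) (ler_wpM2r (exprn_ge0 2 (normr_ge0 _)) KL).
  exact: (uniform_bound mono (fun j => peval_taylor l`_j rr)).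
have [T' T'0 T'P] : exists2 T : R, 0 <= T & forall i : 'I_n, forall x y,
    `|x| <= rr -> `|y| <= rr ->
    `|peval (Q i) y - peval (Q i) x - linear_part (Q i) x y| <= T * `|y - x| ^+ 2.
  have mono := fun (i : 'I_n) (K L : R) (KL : K <= L) (H : forall x y,
    `|x| <= rr -> `|y| <= rr ->
    `|peval (Q i) y - peval (Q i) x - linear_part (Q i) x y| <= K * `|y - x| ^+ 2)
    x y xr yr => le_trans (H x y xr yr) (ler_wpM2r (exprn_ge0 2 (normr_ge0 _)) KL).
  exact: (uniform_bound mono (fun i => peval_taylor (Q i) rr)).
have [D D0 DP] := peval_bounded (det_jac Q) rr.
have [A A0 AP] : exists2 A : R, 0 <= A & forall ji : 'I_(size l) * 'I_n, forall x,
    `|x| <= rr -> `|peval (chart_deriv Q l`_ji.1 ji.2) x| <= A.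
  have mono := fun (ji : 'I_(size l) * 'I_n) (K L : R) (KL : K <= L) (H : forall x,
    `|x| <= rr -> `|peval (chart_deriv Q l`_ji.1 ji.2) x| <= K) x xr => le_trans (H x xr) KL.
  exact: (uniform_bound mono (fun ji => peval_bounded _ rr)).
have abs0 x : 0 <= abs_sum l x by apply: sumr_ge0.
have [C C0 CP] : exists2 C : R, 0 <= C & forall ji : 'I_(size l) * 'I_n, forall x,
    `|x| <= rr -> (k <= ji.2)%N -> `|peval (chart_deriv Q l`_ji.1 ji.2) x| <= C * abs_sum l x.
  have mono := fun (ji : 'I_(size l) * 'I_n) (K L : R) (KL : K <= L) (H : forall x,
    `|x| <= rr -> (k <= ji.2)%N -> `|peval (chart_deriv Q l`_ji.1 ji.2) x| <= K * abs_sum l x)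
    x xr kj => le_trans (H x xr kj) (ler_wpM2r (abs0 x) KL).
  apply: (uniform_bound mono) => -[j i] /=.
  have [ki|ik] := leqP k i; last by exists 0.
  have [B B0 BP] := in_ideal_abs_sum rr (lder _ i (mem_nth 0 (ltn_ord j)) ki).
  by exists B => // x xr _; apply: BP.
pose c1 := n%:R * C / dl; pose c2 := (n%:R * A * T' + D * T) * K ^+ 2 / dl.
have c10 : 0 <= c1 by rewrite /c1 divr_ge0 ?mulr_ge0 // ltW.
have c20 : 0 <= c2.
  by rewrite /c2 divr_ge0 ?mulr_ge0 ?addr_ge0 ?mulr_ge0 ?exprn_ge0 // ltW.
pose m : R := (size l)%:R.
exists r, (m * (c1 + c2)); split=> //; first by rewrite mulr_ge0 // addr_ge0.
move=> x y xa ya Qx Qy u uE; have u0 : 0 <= u by rewrite uE.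
have xr := ballr _ xa; have yr := ballr _ ya.
have wu : `|y - x| <= K * u.
  by rewrite uE; apply: inj;
    [apply: le_trans xa _ | apply: le_trans ya _]; rewrite ge_min lexx.
have w2 : `|y - x| ^+ 2 <= K ^+ 2 * u ^+ 2.
  by rewrite -exprMn lerXn2r ?nnegrE // mulr_ge0 // ltW.
have dx : dl <= `|peval (det_jac Q) x|.
  by apply: dP; apply: le_lt_trans xa _; rewrite gt_min; apply/orP; right; lra.
have step (j : 'I_(size l)) :
    `|peval l`_j y - peval l`_j x| <= c1 * u * abs_sum l x + c2 * u ^+ 2.
  set dv := peval (det_jac Q) x in dx *.
  (* Taylor's formula for the generator, multiplied by [dv]: its linear part is expressed through
     the chart, and the linear part of each Q_i is the increment of Q_i minus a remainder. *)
  have E : dv * (peval l`_j y - peval l`_j x) =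
      \sum_(i < n) peval (chart_deriv Q l`_j i) x * (peval (Q i) y - peval (Q i) x)
      - \sum_(i < n) peval (chart_deriv Q l`_j i) x *
          (peval (Q i) y - peval (Q i) x - linear_part (Q i) x y)
      + dv * (peval l`_j y - peval l`_j x - linear_part l`_j x y).
    transitivity (dv * linear_part l`_j x y +
        dv * (peval l`_j y - peval l`_j x - linear_part l`_j x y)); first by ring.
    congr (_ + _); rewrite chart_deriv_linear_part -sumrB.
    by apply: eq_bigr => i _; ring.
  have bound : `|dv * (peval l`_j y - peval l`_j x)| <=
      n%:R * (C * abs_sum l x * u) + n%:R * (A * (T' * `|y - x| ^+ 2)) +
      D * (T * `|y - x| ^+ 2).
    rewrite E; apply: le_trans (ler_normD _ _) _; apply: lerD; last first.
      by rewrite normrM; apply: ler_pM => //; [apply: DP | apply: TP].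
    apply: le_trans (ler_normB _ _) _.
    have sumn (G : 'I_n -> R) (b : R) : (forall i, `|G i| <= b) -> `|\sum_i G i| <= n%:R * b.
      move=> Gb; apply: le_trans (ler_norm_sum _ _ _) _.
      rewrite mulr_natl -[X in _ *+ X]card_ord -sumr_const.
      exact: ler_sum.
    apply: lerD; apply: sumn => i; rewrite normrM; last first.
      by apply: ler_pM => //; [apply: (AP (j, i)) | apply: T'P].
    have [ki|ik] := leqP k i.
      apply: ler_pM => //; first exact: (CP (j, i)).
      by rewrite uE; have := ler_coord_norm (poly_map Q y - poly_map Q x) 0 i; rewrite !mxE.
    by rewrite Qx // Qy // subrr normr0 mulr0 !mulr_ge0.
  have dlw : dl * `|peval l`_j y - peval l`_j x| <=
      n%:R * (C * abs_sum l x * u) + (n%:R * A * T' + D * T) * (K ^+ 2 * u ^+ 2).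
    apply: (@le_trans _ _ `|dv * (peval l`_j y - peval l`_j x)|).
      by rewrite normrM ler_wpM2r.
    apply: le_trans bound _; rewrite -addrA lerD2l.
    have -> : n%:R * (A * (T' * `|y - x| ^+ 2)) + D * (T * `|y - x| ^+ 2) =
      (n%:R * A * T' + D * T) * `|y - x| ^+ 2 by ring.
    by rewrite ler_wpM2l // addr_ge0 // !mulr_ge0.
  have -> : c1 * u * abs_sum l x + c2 * u ^+ 2 =
    (n%:R * (C * abs_sum l x * u) + (n%:R * A * T' + D * T) * (K ^+ 2 * u ^+ 2)) / dl.
    by rewrite /c1 /c2; field; rewrite gt_eqF.
  by rewrite ler_pdivlMr // mulrC.
have sum_step : abs_sum l y <= abs_sum l x + m * (c1 * u * abs_sum l x + c2 * u ^+ 2).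
  have -> : m * (c1 * u * abs_sum l x + c2 * u ^+ 2) =
      \sum_(j < size l) (c1 * u * abs_sum l x + c2 * u ^+ 2).
    by rewrite sumr_const card_ord mulr_natl.
  rewrite -big_split; apply: ler_sum => j _ /=.
  have split_y : peval l`_j y = peval l`_j x + (peval l`_j y - peval l`_j x) by ring.
  rewrite {1}split_y; apply: le_trans (ler_normD _ _) _; rewrite lerD2l.
  exact: step.
apply: le_trans sum_step _; rewrite -!addrA lerD2l.
have -> : m * (c1 + c2) * u * abs_sum l x + m * (c1 + c2) * u ^+ 2 =
  m * (c1 * u * abs_sum l x + c2 * u ^+ 2) +
  m * (c2 * u * abs_sum l x + c1 * u ^+ 2) by ring.
have m0 : 0 <= m by rewrite /m.
rewrite lerDl; apply: mulr_ge0 => //; apply: addr_ge0; apply: mulr_ge0 => //.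
  exact: mulr_ge0.
exact: exprn_ge0.
Qed.

End ChartIdeals.

(** * Propagation of zeros along segments in a chart *)

Section ChartFlow.
Variables (R : realType) (n : nat).
Local Notation poly := (rpoly R n).
Implicit Types (p q h d : poly) (a x y v : 'rV[R]_n) (Q : nat -> poly) (I : set poly).

Lemma poly_map_near Q a (e : R) : 0 < e ->
  \forall x \near a, `|poly_map Q x - poly_map Q a| <= e.
Proof.
move=> e0; have : \forall x \near a, forall i : 'I_n, `|peval (Q i) a - peval (Q i) x| < e.
  apply: (@filter_forall _ _
    (fun (i : 'I_n) x => `|peval (Q i) a - peval (Q i) x| < e) (nbhs a) _) => i.
  exact: (@cvgr_dist_lt _ _ _ _ (nbhs_filter a) _ _ (@peval_continuous R n (Q i) a)).
apply: filterS => x xe; apply: ler_norm_coord; first exact: ltW.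
by move=> i0 i; rewrite !mxE distrC ltW.
Qed.

Lemma in_ideal_abs_sum0 (l : seq poly) h x :
  in_ideal l h -> abs_sum l x = 0 -> peval h x = 0.
Proof.
move=> lh lx; have [K _ /(_ x (lexx _))] := in_ideal_abs_sum `|x| lh.
by rewrite lx mulr0 normr_le0 => /eqP.
Qed.

(* Along a segment from a in the coordinates Q, with Q_0 = ... = Q_(k-1) = 0, the
   derivatives of the generators of I are combinations of these generators, which
   vanish at a; Gronwall's inequality, in discrete form, shows that they stay 0. *)
Lemma ideal_vanishes_near I Q a k : poly_ideal I -> chart_at Q a -> (k <= n)%N ->
  (forall h, I h -> peval h a = 0) ->
  (forall h (i : 'I_n), I h -> (k <= i)%N -> I (chart_deriv Q h i)) ->
  exists2 W : set 'rV[R]_n, nbhs a W & forall x, W x ->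
    (forall i, (i < k)%N -> peval (Q i) x = 0) -> forall h, I h -> peval h x = 0.
Proof.
move=> idI Qa kn Ia Ider; have [l lI Il] := hilbert_basis I.
have [|r [C [r0 C0 step]]] := @chart_step R n l Q a k Qa.
  by move=> h i /lI Ih ki; apply/Il/Ider.
have [r1 [K [r10 K0 inj surj]]] := inverse_function Qa.2.
have Q0 : poly_map Q a = 0 by apply/rowP => i; rewrite !mxE Qa.1.
pose s := Num.min r r1; have s0 : 0 < s by rewrite lt_min r0.
have [sr sr1] : s <= r /\ s <= r1 by rewrite !ge_min !lexx orbT.
(* The first bound keeps the lifted segment in the ball of radius [s], the second makes C |v| at
   most 1/2, as Gronwall's inequality requires. *)
pose e := Num.min (s / K) (2 * (C + 1))^-1.
have e0 : 0 < e by rewrite lt_min divr_gt0 // invr_gt0; lra.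
exists ([set x | `|x - a| <= s] `&` [set x | `|poly_map Q x - poly_map Q a| <= e]).
  apply: filterI; last exact: poly_map_near.
  by apply/nbhs_normE; exists s => // y /ltW.
move=> x [/= xs]; rewrite Q0 subr0 => xe Qx h Ih.
apply: (in_ideal_abs_sum0 (Il h Ih)).
set v := poly_map Q x in xe.
have vs : K * `|v| <= s.
  by rewrite -ler_pdivlMl // mulrC; apply: le_trans xe _; rewrite ge_min lexx.
have Cv : 0 <= C * `|v| <= 2^-1.
  rewrite mulr_ge0 //=; apply: (@le_trans _ _ (C * (2 * (C + 1))^-1)).
    by rewrite ler_wpM2l //; apply: le_trans xe _; rewrite ge_min lexx orbT.
  by rewrite ler_pdivrMr; lra.
have abs0 y : 0 <= abs_sum l y by apply: sumr_ge0.
(* The segment from 0 to [v] is cut into [N] equal pieces and lifted through the chart; injectivity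
   identifies the ends of the lift with [a] and [x]. *)
have bound N : (0 < N)%N -> abs_sum l x <= 2 * (C * `|v| ^+ 2) / N%:R.
  move=> N0; have NR0 : 0 < N%:R :> R by rewrite ltr0n.
  pose vi i := (i%:R / N%:R : R) *: v.
  have ex_y i : exists y, (i <= N)%N -> `|y - a| <= s /\ poly_map Q y = vi i.
    have [iN|] := leqP i N; last by exists 0.
    have vis : K * `|vi i - poly_map Q a| <= s.
      rewrite Q0 subr0 normrZ ger0_norm ?divr_ge0 //.
      apply: le_trans vs; rewrite ler_wpM2l ?(ltW K0) //.
      by rewrite ler_piMl // ler_pdivrMr // mul1r ler_nat.
    have [|y ya yv] := surj (vi i); first exact: le_trans vis _.
    by exists y => _; split=> //; apply: le_trans ya vis.
  have [y yP] := choice ex_y.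
  have uniq_pre z z' : `|z - a| <= s -> `|z' - a| <= s -> poly_map Q z = poly_map Q z' -> z = z'.
    move=> za z'a E; have := inj z z' (le_trans za sr1) (le_trans z'a sr1).
    by rewrite E subrr normr0 mulr0 normr_le0 subr_eq0 => /eqP.
  have y0 : y 0%N = a.
    have [ya yv] := yP 0%N (leq0n _); apply: uniq_pre => //.
      by rewrite subrr normr0 ltW.
    by rewrite yv Q0 /vi mul0r scale0r.
  have yN : y N = x.
    have [ya yv] := yP N (leqnn _); apply: uniq_pre => //.
    by rewrite yv /vi divff ?scale1r // gt_eqF.
  rewrite -yN; apply: (@discrete_gronwall R (fun i => abs_sum l (y i)) N (C * `|v|)) => //.
  - rewrite y0 /abs_sum big1 // => j _; rewrite Ia ?normr0 //.
    by apply: lI; apply: mem_nth.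
  - by rewrite mulr_ge0 // exprn_ge0.
  move=> i iN; have [ya yv] := yP i (ltnW iN); have [ya' yv'] := yP i.+1 iN.
  have Qy j z (t : R) : poly_map Q z = t *: v -> (j < k)%N -> peval (Q j) z = 0.
    move=> zv jk; have jn := leq_trans jk kn.
    have := congr1 (fun u : 'rV_n => u 0 (Ordinal jn)) zv; rewrite !mxE /= => ->.
    by rewrite Qx // mulr0.
  have := step _ _ (le_trans ya sr) (le_trans ya' sr) (fun j => Qy j _ _ yv)
    (fun j => Qy j _ _ yv') (`|v| / N%:R).
  have -> : poly_map Q (y i.+1) - poly_map Q (y i) = N%:R^-1 *: v.
    rewrite yv yv' /vi -scalerBl -mulrBl -natr1 addrAC subrr add0r mul1r //.
  rewrite normrZ gtr0_norm ?invr_gt0 // mulrC => /(_ erefl).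
  by move/le_trans; apply; rewrite le_eqVlt; apply/orP; left; apply/eqP; field; rewrite gt_eqF.
apply/eqP; rewrite eq_le abs0 andbT leNgt; apply/negP => sx.
pose D := 2 * (C * `|v| ^+ 2); have D0 : 0 <= D by rewrite /D !mulr_ge0.
pose N := Num.bound (D / abs_sum l x).
have DN : D / abs_sum l x < N%:R by apply: archi_boundP; rewrite divr_ge0 // ltW.
have N0 : (0 < N)%N by rewrite -(ltr0n R); apply: le_lt_trans DN; rewrite divr_ge0 // ltW.
have := bound N N0; rewrite leNgt => /negP; apply.
by rewrite ltr_pdivrMr ?ltr0n // [ltRHS]mulrC -ltr_pdivrMr.
Qed.

End ChartFlow.

(** * Zariski closed sets *)

Section Varieties.
Variables (R : realType) (n : nat).
Local Notation poly := (rpoly R n).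
Local Notation Xp j := (mpoly.mpolyX R (mpoly.mnm1 j) : rpoly R n).
Local Notation Cp c := (mpoly.mpolyC n c : rpoly R n).
Implicit Types (p q h d s : poly) (a x y : 'rV[R]_n) (Q : nat -> poly) (I : set poly)
  (A B C U V W X Z : set 'rV[R]_n).

Definition vanishing A : set poly := [set h | forall x, A x -> peval h x = 0].

Lemma vanishing_ideal A : poly_ideal (vanishing A).
Proof.
split=> [x _|p q pA qA x Ax|w p pA x Ax]; first exact: peval0.
- by rewrite pevalD pA ?qA ?addr0.
- by rewrite pevalM pA ?mulr0.
Qed.

Lemma zariski_closedP A :
  zariski_closed A <-> forall x, (forall h, vanishing A h -> peval h x = 0) -> A x.
Proof.
split=> [[S AS] x Ax|AP].
  by rewrite AS => p Sp; apply: Ax => y; rewrite AS; apply.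
exists (vanishing A); apply/seteqP; split=> [x Ax p|x]; [exact | exact: AP].
Qed.

Lemma zariski_closed_not A x : zariski_closed A -> ~ A x ->
  exists2 h, vanishing A h & peval h x != 0.
Proof.
move=> /zariski_closedP AP nAx; apply: contrapT => H; apply: nAx; apply: AP => h Ah.
by apply: contrapT => /eqP hx; apply: H; exists h.
Qed.

Lemma zariski_closed_zeros (S : set poly) :
  zariski_closed [set x | forall p, S p -> peval p x = 0].
Proof. by exists S. Qed.

Lemma zariski_closedI A B :
  zariski_closed A -> zariski_closed B -> zariski_closed (A `&` B).
Proof.
move=> /zariski_closedP AP /zariski_closedP BP; apply/zariski_closedP => x H; split.
  by apply: AP => h Ah; apply: H => y [/Ah].
by apply: BP => h Bh; apply: H => y [_ /Bh].
Qed.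

Lemma zariski_closedU A B :
  zariski_closed A -> zariski_closed B -> zariski_closed (A `|` B).
Proof.
move=> Ac Bc; apply/zariski_closedP => x H; apply: contrapT => /not_orP[nA nB].
have [p Ap px] := zariski_closed_not Ac nA; have [q Bq qx] := zariski_closed_not Bc nB.
have : peval (p * q) x = 0.
  by apply: H => y [/Ap|/Bq] py; rewrite pevalM py ?mul0r ?mulr0.
by move/eqP; rewrite pevalM mulf_eq0 (negPf px) (negPf qx).
Qed.

Lemma zariski_closed1 a : zariski_closed [set a].
Proof.
apply/zariski_closedP => x H; apply/rowP => j.
have : peval (Xp j - Cp (a ord0 j)) x = 0.
  by apply: H => y ->; rewrite pevalB pevalX pevalC subrr.
by rewrite pevalB pevalX pevalC => /eqP; rewrite subr_eq0 => /eqP.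
Qed.

Lemma zariski_closed_finite A : finite_set A -> zariski_closed A.
Proof.
move=> /finite_seqP[l ->]; elim: l => [|a l IH].
  apply/zariski_closedP => x /(_ 1); rewrite peval1 => H.
  by have /eqP : 1 = 0 :> R by [apply: H => y]; rewrite oner_eq0.
have -> : [set` a :: l] = [set a] `|` [set` l].
  apply/seteqP; split=> y /=; rewrite inE; first by case/predU1P; [left | right].
  by case=> [->|yl]; rewrite ?eqxx // yl orbT.
by apply: zariski_closedU IH; apply: zariski_closed1.
Qed.

Lemma zariski_open_inP X U : zariski_open_in X U <->
  U `<=` X /\ forall x, U x -> exists2 s, peval s x != 0 &
    forall y, X y -> peval s y != 0 -> U y.
Proof.
split=> [[A Ac ->]|[UX UP]].
  split=> [x []//|x [Xx nAx]]; have [s As sx] := zariski_closed_not Ac nAx.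
  by exists s => // y Xy sy; split=> // /As/eqP; rewrite (negPf sy).
pose S := [set s | forall y, X y -> peval s y != 0 -> U y].
exists [set x | forall p, S p -> peval p x = 0]; first exact: zariski_closed_zeros.
apply/seteqP; split=> [x Ux|x [Xx nx]].
  split; first exact: UX.
  by have [s sx sU] := UP x Ux; move=> /(_ s sU)/eqP; rewrite (negPf sx).
by move/existsNP: nx => [s /not_implyP[sS /eqP sx]]; apply: sS.
Qed.

(** Division-free form: multiplying p and q by a polynomial s whose nonvanishing forces membership
    in V replaces V by the principal open set where the new denominator is nonzero. *)
Lemma regular_onP X U (f : 'rV[R]_n -> R) : U `<=` X -> regular_on X U f <->
  forall x, U x -> exists p q, peval q x != 0 /\
    forall y, X y -> peval q y != 0 -> U y /\ peval q y * f y = peval p y.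
Proof.
move=> UX; split=> H x Ux.
  have [V [p [q [/zariski_open_inP[VX VP] Vx VU Vpq]]]] := H x Ux.
  have [s sx sV] := VP x Vx; have [qx fx] := Vpq x Vx.
  exists (s * p), (s * q); split; first by rewrite pevalM mulf_neq0.
  move=> y Xy; rewrite !pevalM mulf_eq0 => /norP[sy qy].
  have Vy := sV y Xy sy; split; first exact: VU.
  by have [_ ->] := Vpq y Vy; field.
have [p [q [qx qP]]] := H x Ux.
exists [set y | X y /\ peval q y != 0], p, q; split=> //.
- apply/zariski_open_inP; split=> [y []//|y [Xy qy]].
  by exists q.
- by split=> //; apply: UX.
- by move=> y [Xy qy]; case: (qP y Xy qy).
- move=> y [Xy qy]; split=> //; have [_ <-] := qP y Xy qy.
  by rewrite mulrAC divff ?mul1r.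
Qed.

(** Otherwise there are a strictly decreasing sequence D_k of infinite closed sets and polynomials
    h_k vanishing on D_(k+1) but not on D_k. By [hilbert_seq] some h_N is a combination of its
    predecessors, which all vanish on D_N. *)
Lemma minimal_infinite_closed Z : zariski_closed Z -> infinite_set Z ->
  exists C, [/\ zariski_closed C, C `<=` Z, infinite_set C &
    forall B, zariski_closed B -> B `<=` C -> infinite_set B -> C `<=` B].
Proof.
move=> Zc Zi; apply: contrapT => H.
have Hnext C : exists B, zariski_closed C -> C `<=` Z -> infinite_set C ->
    [/\ zariski_closed B, B `<=` C, infinite_set B & ~ C `<=` B].
  have [[Cc CZ Ci]|nC] := pselect [/\ zariski_closed C, C `<=` Z & infinite_set C];
    last by exists set0 => ? ? ?; case: nC.
  apply: contrapT => /forallNP HB; apply: H; exists C; split=> // B Bc BC Bi.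
  by apply: contrapT => nCB; apply: (HB B).
have [next nextP] := choice Hnext; pose D k := iter k next Z.
have DP k : [/\ zariski_closed (D k), D k `<=` Z & infinite_set (D k)].
  elim: k => [|k [Dc DZ Di]]; first by split.
  by have [? DD ? _] := nextP _ Dc DZ Di; split=> //; apply: subset_trans DD DZ.
have DS k : [/\ zariski_closed (D k.+1), D k.+1 `<=` D k, infinite_set (D k.+1) &
    ~ D k `<=` D k.+1].
  by have [Dc DZ Di] := DP k; apply: nextP.
have Dmono i j : (i <= j)%N -> D j `<=` D i.
  elim: j => [|j IH]; first by rewrite leqn0 => /eqP ->.
  rewrite leq_eqVlt => /predU1P[->//|/IH]; apply: subset_trans.
  by case: (DS j).
have ex_h k : exists h, vanishing (D k.+1) h /\ ~ vanishing (D k) h.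
  have [Dc _ _ /existsNP[x /not_implyP[Dx nDx]]] := DS k.
  have [h Dh hx] := zariski_closed_not Dc nDx; exists h; split=> // /(_ x Dx)/eqP.
  by rewrite (negPf hx).
have [h hP] := choice ex_h; have [N [c hN]] := hilbert_seq h.
apply: (hP N).2 => x Dx; rewrite hN peval_sum big1 // => i _.
have iN : (i < N)%N by rewrite -[X in (_ < X)%N](size_mkseq h N).
rewrite pevalM nth_mkseq //; have [hi _] := hP i.
by rewrite hi ?mulr0 //; apply: Dmono Dx.
Qed.

(** * Minimal infinite algebraic sets *)

Section MinimalInfinite.
Variable C : set 'rV[R]_n.
Hypotheses (Cclosed : zariski_closed C) (Cinf : infinite_set C).
Hypothesis Cmin : forall B, zariski_closed B -> B `<=` C -> infinite_set B -> C `<=` B.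

Lemma minimal_zeros_finite h : ~ vanishing C h -> finite_set (C `&` [set x | peval h x = 0]).
Proof.
move=> Ch; apply: contrapT => inf; apply: Ch => x Cx.
suff : (C `&` [set x | peval h x = 0]) x by case.
apply: (Cmin _ _ inf) => //.
apply: zariski_closedI => //; exists [set h].
by apply/seteqP; split=> [y /= hy p -> //|y /= /(_ h erefl)].
Qed.

(** If neither factor vanished on [C], then [C] would be the union of two finite sets. *)
Lemma minimal_prime h1 h2 : vanishing C (h1 * h2) -> vanishing C h1 \/ vanishing C h2.
Proof.
move=> C12; apply: contrapT => /not_orP[/minimal_zeros_finite f1 /minimal_zeros_finite f2].
apply: Cinf; apply: sub_finite_set (_ : finite_set (_ `|` _)); last first.
  by rewrite finite_setU; split; [exact: f1 | exact: f2].
move=> x Cx; have /eqP := C12 x Cx; rewrite pevalM mulf_eq0.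
by move=> /orP[/eqP hx|/eqP hx]; [left | right].
Qed.

End MinimalInfinite.

End Varieties.

(** * Nonsingular points *)

Section NonsingularLocal.
Variables (R : realType) (n : nat).
Local Notation poly := (rpoly R n).
Local Notation Xp j := (mpoly.mpolyX R (mpoly.mnm1 j) : rpoly R n).
Local Notation Cp c := (mpoly.mpolyC n c : rpoly R n).
Implicit Types (p q h d s : poly) (a x y : 'rV[R]_n) (Q : nat -> poly) (I : set poly)
  (A B C U V W X Z : set 'rV[R]_n).

Definition in_grad_span k Q x (u : 'I_n -> R) := exists c : nat -> R,
  forall j, u j = \sum_(i < k) c i * peval (mpoly.mderiv j (Q i)) x.

Definition grad_indep k Q x := forall c : nat -> R,
  (forall j, \sum_(i < k) c i * peval (mpoly.mderiv j (Q i)) x = 0) ->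
  forall i, (i < k)%N -> c i = 0.

Lemma eq_grad_indep k Q Q' x : (forall i, (i < k)%N -> Q i = Q' i) ->
  grad_indep k Q x -> grad_indep k Q' x.
Proof.
move=> QQ' ind c cQ; apply: ind => j; rewrite -[RHS](cQ j).
by apply: eq_bigr => i _; rewrite QQ'.
Qed.

(** Index [k] receives [h]; the entries beyond it are fillers. *)
Definition extend_family k Q h : nat -> poly := fun i => if (i < k)%N then Q i else h.

Lemma grad_indep_extend k Q h x : grad_indep k Q x ->
  ~ in_grad_span k Q x (fun j => peval (mpoly.mderiv j h) x) ->
  grad_indep k.+1 (extend_family k Q h) x.
Proof.
move=> ind nspan c cQ.
have sumE j : \sum_(i < k) c i * peval (mpoly.mderiv j (Q i)) x +
    c k * peval (mpoly.mderiv j h) x = 0.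
  rewrite -[RHS](cQ j) big_ord_recr /= /extend_family ltnn; congr (_ + _).
  by apply: eq_bigr => i _; rewrite ltn_ord.
have ck : c k = 0.
  apply: contrapT => /eqP ck; apply: nspan; exists (fun i => - c i / c k) => j.
  have : c k * peval (mpoly.mderiv j h) x = - \sum_(i < k) c i * peval (mpoly.mderiv j (Q i)) x.
    by apply/eqP; rewrite -addr_eq0 addrC sumE.
  move=> /(congr1 (fun t => (c k)^-1 * t)); rewrite mulKf // => ->.
  rewrite -sumrN mulr_sumr; apply: eq_bigr => i _.
  by field.
move=> i; rewrite ltnS leq_eqVlt => /predU1P[->//|]; apply: ind => j.
by rewrite -[RHS](sumE j) ck mul0r addr0.
Qed.

(** Otherwise the identity matrix of size n would factor through dimension k < n. *)
Lemma grad_indep_exists_coord k Q x : (k < n)%N -> exists j0 : 'I_n,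
  ~ in_grad_span k Q x (fun j => (j == j0)%:R).
Proof.
move=> kn; apply: contrapT => /forallNP H.
have span j0 : exists c : nat -> R, forall j, (j == j0)%:R =
    \sum_(i < k) c i * peval (mpoly.mderiv j (Q i)) x.
  exact: (contrapT (H j0)).
have [c cP] := choice span.
have : (\matrix_(j0 < n, i < k) c j0 i) *m
    (\matrix_(i < k, j < n) peval (mpoly.mderiv j (Q i)) x) = 1%:M :> 'M[R]_n.
  apply/matrixP => j0 j; rewrite !mxE eq_sym cP.
  by apply: eq_bigr => i _; rewrite !mxE.
move=> /(congr1 mxrank); rewrite mxrank1 => rk.
have := mxrankM_maxr (\matrix_(j0 < n, i < k) c j0 i)
  (\matrix_(i < k, j < n) peval (mpoly.mderiv j (Q i)) x).
by rewrite rk => /leq_trans/(_ (rank_leq_row _)); rewrite leqNgt kn.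
Qed.

Lemma grad_indep_row_free k Q x : grad_indep k Q x ->
  row_free (Defs.jacobian (fun i : 'I_k => Q i) x).
Proof.
move=> ind; apply/inj_row_free => u uJ.
pose c i := if insub i is Some k then u 0 k else 0.
have cE (i : 'I_k) : c i = u 0 i by rewrite /c valK.
apply/rowP => i; rewrite mxE -cE; apply: ind => // j.
have := congr1 (fun v : 'rV_n => v 0 j) uJ; rewrite !mxE => {2}<-.
by apply: eq_bigr => l _; rewrite cE mxE.
Qed.

Lemma grad_indep_le k Q x : grad_indep k Q x -> (k <= n)%N.
Proof. by move=> /grad_indep_row_free /eqP <-; apply: rank_leq_col. Qed.

Lemma grad_indep_unit Q x : grad_indep n Q x -> jac Q x \in unitmx.
Proof. by rewrite -row_free_unit; apply: grad_indep_row_free. Qed.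

Lemma unit_grad_indep k Q x : (k <= n)%N -> jac Q x \in unitmx -> grad_indep k Q x.
Proof.
rewrite -row_free_unit => kn /row_free_inj inj c cQ i ik.
pose u := (\row_(l < n) if (l < k)%N then c l else 0) : 'rV[R]_n.
have /(inj 1 _ 0)/rowP/(_ (Ordinal (leq_trans ik kn))) : u *m jac Q x = 0 *m jac Q x.
  rewrite mul0mx; apply/rowP => j; rewrite !mxE -[RHS](cQ j).
  rewrite (big_ord_widen n (fun i => c i * peval (mpoly.mderiv j (Q i)) x) kn) [RHS]big_mkcond.
  by apply: eq_bigr => l _; rewrite !mxE; case: ifP => _ //; rewrite mul0r.
by rewrite !mxE /= ik.
Qed.

(** By J adj(J) = det(J) I, the i-th chart derivative of Q_l vanishes for l < k <= i, and the
    gradient of [h] at [x] is a combination of those of the Q_l. The contrapositive detects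
    independent gradients. *)
Lemma chart_deriv_span k Q h x (i : 'I_n) : (k <= i)%N ->
  in_grad_span k Q x (fun j => peval (mpoly.mderiv j h) x) ->
  peval (chart_deriv Q h i) x = 0.
Proof.
move=> ki [c cQ]; rewrite /chart_deriv mxE peval_sum.
set J := (\matrix_(i < n, j < n) mpoly.mderiv j (Q i) : 'M[poly]_n)%R.
under eq_bigr => j _ do rewrite pevalM mxE cQ mulr_suml.
rewrite exchange_big big1 // => l _ /=.
have ln : (l < n)%N by apply: leq_trans (ltn_ord l) (leq_trans ki (ltnW (ltn_ord i))).
have := congr1 (fun A : 'M[poly]_n => peval (A (Ordinal ln) i) x) (mul_mx_adj J).
rewrite !mxE -val_eqE /= peval_sum.
rewrite (_ : (l == i :> nat) = false) ?mulr0n ?peval0; last first.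
  by apply/negbTE; rewrite neq_ltn (leq_trans (ltn_ord l) ki).
move=> H; transitivity (c l * 0); last by rewrite mulr0.
rewrite -[X in c l * X]H mulr_sumr; apply: eq_bigr => j _.
by rewrite pevalM [J _ j]mxE mulrA.
Qed.

(** Functions X_j - a_j are adjoined one at a time, with j chosen so that the new gradient lies
    outside the span of those present. *)
Lemma complete_chart k Q a : (k <= n)%N -> grad_indep k Q a ->
  (forall i, (i < k)%N -> peval (Q i) a = 0) ->
  exists Q', (forall i, (i < k)%N -> Q' i = Q i) /\ chart_at Q' a.
Proof.
move=> kn; rewrite -(subKn kn); have := leq_subr k n.
elim: (n - k)%N Q => [|m IH] Q mn.
  rewrite subn0 => ind Qa; exists Q; split=> //; split=> //.
  exact: grad_indep_unit.
set l := (n - m.+1)%N; have lS : (n - m)%N = l.+1 by rewrite /l; lia.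
have ln : (l < n)%N by rewrite /l; lia.
rewrite lS in IH => ind Qa.
have [j0 nspan] := grad_indep_exists_coord Q a ln.
pose h := Xp j0 - Cp (a 0 j0).
have hE : (fun j => peval (mpoly.mderiv j h) a) = (fun j => (j == j0)%:R).
  apply/funext => j; rewrite mpoly.mderivB mderivXU mpoly.mderivC subr0.
  by case: eqP; rewrite ?peval1 ?peval0.
have [||Q' [Q'Q Q'a]] := IH (extend_family l Q h) (ltnW mn).
- by apply: grad_indep_extend => //; rewrite hE.
- move=> i _; rewrite /extend_family; case: ltnP => il; first exact: Qa.
  by rewrite pevalB pevalX pevalC subrr.
exists Q'; split=> // i il; rewrite Q'Q ?ltnS 1?ltnW // /extend_family il //.
Qed.

(** [X] is a smooth complete intersection at [x]; the nonvanishing of [s] describes a Zariski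
    neighbourhood in which the Q_i have no further zeros. *)
Definition local_equations X c Q x :=
  [/\ (c <= n)%N, forall i, (i < c)%N -> vanishing X (Q i), grad_indep c Q x &
    exists2 s, peval s x != 0 &
      forall y, peval s y != 0 -> (forall i, (i < c)%N -> peval (Q i) y = 0) -> X y].

Lemma eq_local_equations X c Q Q' x : (forall i, (i < c)%N -> Q i = Q' i) ->
  local_equations X c Q x -> local_equations X c Q' x.
Proof.
move=> QQ' [cn QX ind [s sx sX]]; split=> // [i ic||].
- by rewrite -QQ' //; apply: QX.
- exact: eq_grad_indep ind.
- by exists s => // y sy Qy; apply: sX => // i ic; rewrite QQ' // Qy.
Qed.

Lemma nonsingular_local_equations X dim x : X x -> nonsingular_at X dim x ->
  exists Q, (dim <= n)%N /\ local_equations X (n - dim) Q x.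
Proof.
move=> Xx [c [P [cd PX rk [U /zariski_open_inP[_ UP] [Ux XU]]]]].
have -> : (n - dim)%N = c by lia.
pose Q i := if insub i is Some k then P k else 0.
have QE (i : 'I_c) : Q i = P i by rewrite /Q valK.
exists Q; split; first by lia.
split=> [|i ic y Xy|e eQ i ic|].
- by lia.
- by rewrite -[i]/(val (Ordinal ic)) QE PX.
- have free : row_free (Defs.jacobian P x) by rewrite /row_free rk.
  have /row_free_inj inj : row_free (Defs.jacobian P x) by [].
  have /(inj 1 _ 0)/rowP/(_ (Ordinal ic)) :
      (\row_(i < c) e i) *m Defs.jacobian P x = 0 *m Defs.jacobian P x.
    rewrite mul0mx; apply/rowP => j; rewrite !mxE -[RHS](eQ j).
    by apply: eq_bigr => k _; rewrite !mxE QE.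
  by rewrite !mxE.
have [s sx sU] := UP x Ux; exists s => // y sy Qy.
have : ([set y | forall i, peval (P i) y = 0] `&` U) y.
  by split; [move=> i; rewrite -QE Qy | apply: sU].
by rewrite -XU => -[].
Qed.

(** Near [x] the common zeros of Q_0, ..., Q_(c-1) lie in [X], so [germ_ideal_generates] makes some
    [d * h] a combination of these Q_i, which vanish on all of [X]. Vanishing on a Euclidean
    neighbourhood thus becomes a global statement. *)
Lemma local_vanishing X c Q x W h : X x -> local_equations X c Q x -> nbhs x W ->
  (forall y, X y -> W y -> peval h y = 0) ->
  exists2 d, peval d x != 0 & vanishing X (d * h).
Proof.
move=> Xx [cn QX ind [s sx sX]] Wx hW.
have [|Q' [Q'Q Q'x]] := complete_chart cn ind; first by move=> i ic; apply: QX.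
have [|y [Wy /= sy] Qy|d [e [dx dh]]] :=
  @germ_ideal_generates R n Q' x c (W `&` [set y | peval s y != 0]) h Q'x cn.
- by apply: filterI => //; apply: near_peval_neq0.
- apply: hW => //; apply: sX => // i ic; rewrite -Q'Q //; exact: Qy.
exists d => // y Xy; rewrite dh peval_sum big1 // => i _.
by rewrite pevalM Q'Q // QX // mulr0.
Qed.

(** The form in which nonsingularity enters below; [n - 2 <= c] expresses that the local dimension
    is at most 2. *)
Definition locally_chartable X := forall x, X x -> exists c Q,
  (n - 2 <= c)%N /\ local_equations X c Q x.

Lemma nonsingular_surface_chartable X : nonsingular_surface X -> locally_chartable X.
Proof.
move=> [_ _ Xns] x Xx; have [dim d2 /(nonsingular_local_equations Xx)[Q [dn QX]]] := Xns x Xx.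
by exists (n - dim)%N, Q; split=> //; lia.
Qed.

(** If [W] missed [U], the equations l_i of the complement would vanish on [X] near [x], so that d_i
    l_i = 0 on [X] for some d_i with d_i(x) != 0. The product of the d_i would vanish on [U], hence
    on [X] by density, but not at [x]. *)
Lemma zariski_dense_euclidean X U x W : locally_chartable X ->
  zariski_open_in X U -> zariski_dense_in X U -> X x -> nbhs x W ->
  exists2 y, U y & W y.
Proof.
move=> Xns [A Ac UE] Ud Xx Wx; apply: contrapT => UW.
have [l lA Al] := hilbert_basis (vanishing A).
have [c [Q [_ QX]]] := Xns x Xx.
have ex_d (i : 'I_(size l)) : exists d, peval d x != 0 /\ vanishing X (d * l`_i).
  have [|d dx dX] := @local_vanishing X c Q x W l`_i Xx QX Wx; last by exists d.
  move=> y Xy Wy; apply: contrapT => ly; apply: UW; exists y => //.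
  by rewrite UE; split=> // Ay; apply: ly; apply: lA => //; apply: mem_nth.
have [d dP] := choice ex_d.
have : X `<=` [set y | peval (\prod_i d i) y = 0].
  apply: Ud; first by exists [set (\prod_i d i)];
    apply/seteqP; split=> [y /= dy p -> //|y /= /(_ _ erefl)].
  move=> y; rewrite UE => -[Xy nAy]; have [h Ah hy] := zariski_closed_not Ac nAy.
  have [e he] := Al h Ah.
  have [i ly] : exists i : 'I_(size l), peval l`_i y != 0.
    apply: contrapT => /forallNP H; move/eqP: hy; apply; rewrite he peval_sum.
    by rewrite big1 // => i _; rewrite pevalM (_ : peval l`_i y = 0) ?mulr0 //;
      apply: contrapT => /eqP; apply: H.
  have /eqP := (dP i).2 y Xy; rewrite pevalM mulf_eq0 (negPf ly) orbF => /eqP dy.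
  by rewrite /= (bigD1 i) //= pevalM dy mul0r.
move=> /(_ x Xx)/=; rewrite peval_prod => /eqP; apply/negP.
by rewrite prodf_seq_neq0; apply/allP => i _; case: (dP i).
Qed.

End NonsingularLocal.

(** * Locally bounded regular functions have finitely many poles *)

Section PolesFinite.
Variables (R : realType) (n : nat).
Local Notation poly := (rpoly R n).
Local Notation Xp j := (mpoly.mpolyX R (mpoly.mnm1 j) : rpoly R n).
Local Notation Cp c := (mpoly.mpolyC n c : rpoly R n).
Implicit Types (p q h d s : poly) (a x y : 'rV[R]_n) (Q : nat -> poly) (I : set poly)
  (A B C V W Z : set 'rV[R]_n).

Variables (X U : set 'rV[R]_n) (g : 'rV[R]_n -> R).
Hypotheses (Xclosed : zariski_closed X) (Xchart : locally_chartable X).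
Hypotheses (Uopen : zariski_open_in X U) (Udense : zariski_dense_in X U).

Definition denominators : set poly :=
  [set q | exists p, forall y, U y -> peval q y * g y = peval p y].

Definition germ_denominators x : set poly := [set q | exists p W, nbhs x W /\
  forall y, U y -> W y -> peval q y * g y = peval p y].

Lemma denominators_ideal : poly_ideal denominators.
Proof.
split=> [|q q' [p qp] [p' qp']|w q [p qp]].
- by exists 0 => y _; rewrite !peval0 mul0r.
- by exists (p + p') => y Uy; rewrite !pevalD mulrDl qp ?qp'.
- by exists (w * p) => y Uy; rewrite !pevalM -mulrA qp.
Qed.

Lemma germ_denominators_ideal x : poly_ideal (germ_denominators x).
Proof.
split=> [|q q' [p [W [Wx qp]]] [p' [W' [W'x qp']]]|w q [p [W [Wx qp]]]].
- by exists 0, setT; split=> [|y _ _]; [apply: filterT | rewrite !peval0 mul0r].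
- exists (p + p'), (W `&` W'); split; first exact: filterI.
  by move=> y Uy [Wy W'y]; rewrite !pevalD mulrDl qp ?qp'.
- by exists (w * p), W; split=> // y Uy Wy; rewrite !pevalM -mulrA qp.
Qed.

Lemma denominators_germ x q : denominators q -> germ_denominators x q.
Proof.
by move=> [p qp]; exists p, setT; split=> [|y Uy _]; [apply: filterT | apply: qp].
Qed.

Let UX : U `<=` X. Proof. by case/zariski_open_inP: Uopen. Qed.

Lemma dense_eq0 h W y : (forall z, U z -> W z -> peval h z = 0) ->
  X y -> nbhs y W -> peval h y = 0.
Proof.
move=> hW Xy Wy; apply: contrapT => /eqP hy.
have [z Uz [Wz /= hz]] := zariski_dense_euclidean Xchart Uopen Udense Xy
  (filterI Wy (near_peval_neq0 hy)).
by move/eqP: hz; apply; apply: hW.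
Qed.

(** If q(y) = 0 and p(y) != 0, then p^2 - K^2 q^2 is positive at [y], hence at some point of [U] in
    [W], where the bound makes it nonpositive. *)
Lemma dense_bounded0 p q (K : R) W y :
  (forall z, U z -> W z -> `|peval p z| <= K * `|peval q z|) ->
  X y -> nbhs y W -> peval q y = 0 -> peval p y = 0.
Proof.
move=> pq Xy Wy qy; apply: contrapT => /eqP py.
pose w := p ^+ 2 - Cp (K ^+ 2) * q ^+ 2.
have wE z : peval w z = peval p z ^+ 2 - K ^+ 2 * peval q z ^+ 2.
  by rewrite pevalB pevalM pevalC !expr2 !pevalM.
have wy : 0 < peval w y.
  by rewrite wE qy expr0n mulr0 subr0 lt_neqAle eq_sym sqrf_eq0 py sqr_ge0.
have near_w : \forall z \near y, 0 < peval w z.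
  have := @cvgr_dist_lt _ _ _ _ (nbhs_filter y) _ _ (@peval_continuous R n w y) _ wy.
  by apply: filterS => z; rewrite ltr_norml => /andP[_]; lra.
have [z Uz [Wz /= wz]] := zariski_dense_euclidean Xchart Uopen Udense Xy
  (filterI Wy near_w).
move: wz; rewrite wE ltNge => /negP; apply; rewrite subr_le0.
have H := pq z Uz Wz.
rewrite -[peval p z ^+ 2]real_normK ?num_real // -[peval q z ^+ 2]real_normK ?num_real //.
rewrite -exprMn.
by rewrite lerXn2r ?nnegrE // (le_trans _ H).
Qed.

Hypothesis g_regular : regular_on X U g.

Lemma denominators_unit x : U x -> exists2 q, denominators q & peval q x != 0.
Proof.
move/(regular_onP g UX): g_regular => greg /greg[p [q [qx qP]]].
exists (q * q); last by rewrite pevalM mulf_neq0.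
exists (q * p) => y Uy; rewrite !pevalM -mulrA.
have [->|qy] := eqVneq (peval q y) 0; first by rewrite !mul0r.
by have [_ ->] := qP y (UX Uy) qy.
Qed.

(** Over the reals, the sum of the squares of the generators vanishes only where all generators do,
    which never happens on [U]. *)
Lemma common_denominator : exists2 q, denominators q & forall y, U y -> peval q y != 0.
Proof.
have [l lD Dl] := hilbert_basis denominators.
exists (\sum_(i < size l) l`_i * l`_i).
  apply: poly_ideal_sum => [|i _]; first exact: denominators_ideal.
  by have [_ _ M] := denominators_ideal; apply/M/lD/mem_nth.
move=> y /denominators_unit[q /Dl[e qE]]; apply: contra_neq => sy.
rewrite qE peval_sum big1 // => i _; rewrite pevalM.
have : \sum_(i < size l) peval l`_i y * peval l`_i y = 0.
  apply: etrans sy; rewrite peval_sum; apply: eq_bigr => j _.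
  by rewrite pevalM.
move/psumr_eq0P => /(_ (fun i _ => sqr_ge0 _))/(_ i isT)/eqP.
by rewrite mulf_eq0 orbb => /eqP ->; rewrite mulr0.
Qed.

(** With a common denominator [q1] of numerator [p1], the polynomial p q1 - q p1 vanishes on [X]
    near [x]. By [local_vanishing] its product with some d vanishes on all of [X], and q1 can be
    cancelled on [U]. *)
Lemma germ_denominators_lift x q : X x -> germ_denominators x q ->
  exists2 d, peval d x != 0 & denominators (d * q).
Proof.
move=> Xx [p [W [Wx qp]]]; have [q1 [p1 qp1] q1U] := common_denominator.
have [c [Q [_ QX]]] := Xchart Xx.
have [||d dx dX] := @local_vanishing _ _ X c Q x (W°) (p * q1 - q * p1) Xx QX.
- exact: nbhs_interior.
- move=> y Xy Wy; apply: dense_eq0 Xy Wy => z Uz Wz.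
  by rewrite pevalB !pevalM -qp // -qp1 //; ring.
exists d => //; exists (d * p) => y Uy.
apply: (mulfI (q1U y Uy)); have := dX y (UX Uy).
rewrite !(pevalM, pevalB) -qp1 // => H.
apply/eqP; rewrite -subr_eq0; apply/eqP; rewrite -[RHS]oppr0 -[in RHS]H; ring.
Qed.

Hypothesis g_bounded : forall x, X x -> exists (K : R) W, nbhs x W /\
  forall y, U y -> W y -> `|g y| <= K.

(** * Exclusion of a curve of poles *)

Section MinimalCurve.
Variable C : set 'rV[R]_n.
Hypotheses (Cclosed : zariski_closed C) (Cinf : infinite_set C).
Hypothesis Cmin : forall B, zariski_closed B -> B `<=` C -> infinite_set B -> C `<=` B.
Hypotheses (CX : C `<=` X) (CD : forall q, denominators q -> vanishing C q).

Let UnC y : U y -> ~ C y.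
Proof. by move=> /denominators_unit[q /CD Cq qy] /Cq /eqP; apply/negP. Qed.

(** The first [c] members are local equations of [X], and all [k] vanish on [C]; the largest such
    [k] plays the role of the codimension of [C]. *)
Definition curve_family k := exists x c Q,
  [/\ C x, (n - 2 <= c <= k)%N, local_equations X c Q x,
      forall i, (i < k)%N -> vanishing C (Q i) & grad_indep k Q x].

Lemma maximal_curve_family : exists2 k, curve_family k & ~ curve_family k.+1.
Proof.
have ex : exists k, `[< curve_family k >].
  have [x Cx] : C !=set0 by apply: infinite_setN0.
  have [c [Q [cn QX]]] := Xchart (CX Cx).
  exists c; apply/asboolP; exists x, c, Q; split=> //; first by rewrite cn leqnn.
    by case: QX => _ QX _ _ i ic y /CX; apply: QX.
  by case: QX.
have bound k : `[< curve_family k >] -> (k <= n)%N.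
  by move=> /asboolP[x [c [Q [_ _ _ _ /grad_indep_le]]]].
have [k /asboolP kP kmax] := ex_maxnP ex bound; exists k => // /asboolP/kmax.
by rewrite ltnn.
Qed.

(** Suppose [h] vanishes on [C] but one of its chart derivatives in a direction i >= k does not. By
    primality some point of [C] has this derivative, det(J_Q) and [w] all nonzero, and there [h]
    enlarges the family. So the ideal of [C] is stable under these derivatives, and
    [ideal_vanishes_near] applies. *)
Lemma curve_family_locus k x c Q : (k <= n)%N -> C x -> (n - 2 <= c <= k)%N ->
  local_equations X c Q x -> chart_at Q x -> (forall i, (i < k)%N -> vanishing C (Q i)) ->
  ~ curve_family k.+1 ->
  exists2 W, nbhs x W & forall y, W y -> (forall i, (i < k)%N -> peval (Q i) y = 0) -> C y.
Proof.
move=> kn Cx ck QX Qx QC kmax.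
have [cn QX0 ind [w wx wX]] := QX.
have [|h i Ch ki|W Wx WC] := @ideal_vanishes_near R n (vanishing C) Q x k
  (vanishing_ideal C) Qx kn; first by move=> h; apply.
  apply: contrapT => nder.
  have nC p : peval p x != 0 -> ~ vanishing C p by move=> px /(_ x Cx)/eqP; apply/negP.
  have : ~ vanishing C (chart_deriv Q h i * (det_jac Q * w)).
    move=> /(minimal_prime Cclosed Cinf Cmin)[//|].
    move=> /(minimal_prime Cclosed Cinf Cmin)[]; apply: nC => //.
    by rewrite -jac_unit_det; case: Qx.
  move=> /existsNP[y /not_implyP[Cy /eqP]]; rewrite !pevalM !mulf_eq0 => /norP[dy /norP[jy wy]].
  rewrite -jac_unit_det in jy.
  have /andP[nc ck'] := ck.
  apply: kmax; exists y, c, (extend_family k Q h); split=> //.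
  - by rewrite nc ltnW // ltnS.
  - apply: (@eq_local_equations _ _ _ _ Q) => [j jc|].
      by rewrite /extend_family (leq_trans jc ck').
    split=> //; first by apply: unit_grad_indep.
    by exists w.
  - by move=> j jk; rewrite /extend_family; case: ltnP => // jk'; apply: QC.
  - apply: grad_indep_extend; first exact: unit_grad_indep.
    by move=> /(chart_deriv_span ki) /eqP; apply/negP.
exists W => // y Wy Qy; move/zariski_closedP: Cclosed; apply => h Ch.
exact: WC Qy h Ch.
Qed.

(* Near a point x of C where the family is maximal, C is the zero locus of
   Q_0, ..., Q_(k-1) by [curve_family_locus].  If k = n then C = {x}; if k = c then C
   is a neighbourhood of x in X, against the density of U.  Otherwise t = Q_c is a
   local equation of the curve C on the surface X, and it divides every germ of
   denominator q together with q g, since the latter is O(q).  Hence the ideal of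
   these germs is zero by Nakayama's lemma. *)
Lemma minimal_curve_absurd : False.
Proof.
have [k [x [c [Q0 [Cx /andP[nc ck] Q0X Q0C ind]]]] kmax] := maximal_curve_family.
have kn := grad_indep_le ind; have Xx := CX Cx.
have [Q [QQ0 Qx]] := complete_chart kn ind (fun i ik => Q0C i ik x Cx).
have QC i : (i < k)%N -> vanishing C (Q i) by move=> ik; rewrite QQ0 //; apply: Q0C.
have QX : local_equations X c Q x.
  by apply: eq_local_equations Q0X => i ic; rewrite QQ0 // (leq_trans ic).
have [cn QX0 _ [s sx sX]] := QX.
have nck : (n - 2 <= c <= k)%N by rewrite nc.
have [W0 W0x W0C] := curve_family_locus kn Cx nck QX Qx QC kmax.
have [kn'|kn'] := leqP n k.
  have Cprime := minimal_prime Cclosed Cinf Cmin.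
  apply: Cinf; apply: (sub_finite_set _ (finite_set1 x)) => y Cy; apply/rowP => j.
  have [|d [e [dx dh]]] := @chart_generates R n Q x (Xp j - Cp (x ord0 j)) Qx.
    by rewrite pevalB pevalX pevalC subrr.
  have /Cprime[/(_ x Cx)/eqP|/(_ y Cy)/eqP] : vanishing C (d * (Xp j - Cp (x ord0 j))).
  - move=> z Cz; rewrite dh peval_sum big1 // => i _; rewrite pevalM QC ?mulr0 //.
    exact: leq_trans (ltn_ord i) kn'.
  - by rewrite (negPf dx).
  - by rewrite pevalB pevalX pevalC subr_eq0 => /eqP.
have [ck'|ck'] := leqP k c.
  have [y Uy W0y] := zariski_dense_euclidean Xchart Uopen Udense Xx W0x.
  apply: (UnC Uy); apply: W0C => // i ik; apply: QX0 (UX Uy).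
  exact: leq_trans ik ck'.
(* The only case left, since n - 2 <= c < k < n. *)
have kE : k = c.+1 by lia.
pose t := Q c; have tC : vanishing C t by apply: QC; rewrite kE.
have t0 : peval t x = 0 by apply: tC.
(* Up to a factor nonzero at [x] and modulo the ideal of [X], germs vanishing on the locus Q_0 = ...
   = Q_c = 0 are multiples of [t]. *)
have gen h V : nbhs x V ->
    (forall y, V y -> (forall i, (i < k)%N -> peval (Q i) y = 0) -> peval h y = 0) ->
    exists d e, peval d x != 0 /\ vanishing X (d * h - t * e).
  move=> Vx hV; have [d [e [dx dh]]] := germ_ideal_generates Qx kn Vx hV.
  exists d, (e c); split=> // y Xy; rewrite dh kE big_ord_recr /= [t * _]mulrC addrK.
  rewrite peval_sum big1 // => i _; rewrite pevalM QX0 ?mulr0 //.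
(* If [q] did not vanish on [C], its zeros there would be finite in number. Moving [x] slightly
   along Q_k, which stays in [C], reaches a point where [q] is nonzero; there [q] lifts to a global
   denominator, which vanishes on [C]. *)
have germ_C q : germ_denominators x q -> vanishing C q.
  move=> [p [W [Wx qp]]]; apply: contrapT => nCq.
  have [y [Cy Wy qy]] : exists y, [/\ C y, nbhs y W & peval q y != 0].
    apply: contrapT => /forallNP H.
    pose F := C `&` [set y | peval q y = 0].
    have Fc : zariski_closed (F `\ x).
      apply: zariski_closed_finite; apply: sub_finite_set (@subDsetl _ F [set x]) _.
      exact: (minimal_zeros_finite Cclosed Cmin).
    have [h Fh hx] : exists2 h, vanishing (F `\ x) h & peval h x != 0.
      by apply: zariski_closed_not => // -[_]; apply.
    have [y [[W0y [Wy hy]] Qky Qy]] := chart_perturb Qx.2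
      (filterI W0x (filterI (nbhs_interior Wx) (near_peval_neq0 hx))) kn'.
    have Cy : C y.
      apply: W0C => // i ik; rewrite Qy ?neq_ltn ?ik ?(ltn_trans ik) //.
      by apply: Qx.1; apply: ltn_trans kn'.
    apply: (H y); split=> //; apply/eqP => qy; move/eqP: hy; apply; apply: Fh.
    split=> // yx; move: Qky; rewrite yx eqxx.
    by [].
  have [|d dy /CD/(_ y Cy)/eqP] := germ_denominators_lift (CX Cy) (q := q).
    by exists p, W.
  by rewrite pevalM mulf_eq0 (negPf dy) (negPf qy).
have step q : germ_denominators x q -> exists d q',
    [/\ peval d x != 0, germ_denominators x q' & vanishing X (d * q - t * q')].
  move=> Dq; have [p [W [Wx qp]]] := Dq; have qC := germ_C q Dq.
  have [K [Wb [Wbx gK]]] := g_bounded Xx.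
  have [y W0y Qy|d [q' [dx dq]]] := gen q W0 W0x; first by apply/qC/W0C.
  have [|y [W0y Vy] Qy|d' [p' [d'x dp]]] := gen p (W0 `&` (W `&` Wb)°).
  - by apply: filterI => //; apply: nbhs_interior; apply: filterI.
  - have Cy := W0C y W0y Qy; apply: (dense_bounded0 (q := q) (K := K) _ (CX Cy) Vy).
      move=> z Uz [Wz Wbz]; rewrite -qp // normrM mulrC.
      by rewrite ler_wpM2r // gK.
    exact: qC.
  exists (d' * d), (d' * q'); split; first by rewrite pevalM mulf_neq0.
  - have [q1 [p1 qp1] q1U] := common_denominator.
    (* On [U], F = q1 (d' q' g - d p'), so d' q' g = d p' wherever F = 0. Dividing q g = p by [t]
       directly yields only t F = 0. *)
    pose F := d' * q' * p1 - d * p' * q1.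
    have tF y : X y -> nbhs y W -> peval (t * F) y = 0.
      move=> Xy; apply: dense_eq0 Xy => z Uz Wz; have Xz := UX Uz.
      have := dq z Xz; have := dp z Xz; rewrite !(pevalB, pevalM) -qp // -qp1 // => E1 E2.
      transitivity ((peval d' z * peval q1 z * g z) * (peval t z * peval q' z) -
        (peval d z * peval q1 z) * (peval t z * peval p' z)); first by ring.
      move/eqP: E1; rewrite subr_eq0 => /eqP <-; move/eqP: E2; rewrite subr_eq0 => /eqP <-.
      by ring.
    exists (d * p'), (W° `&` [set y | jac Q y \in unitmx] `&` [set y | peval s y != 0]).
    split.
      apply: filterI; last exact: near_peval_neq0.
      apply: filterI; first exact: nbhs_interior.
      have : peval (det_jac Q) x != 0 by rewrite -jac_unit_det Qx.2.
      by move/near_peval_neq0; apply: filterS => y /=; rewrite jac_unit_det.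
    move=> y Uy [[Wy /= Jy] sy]; have Xy := UX Uy.
    suff : peval F y = 0.
      rewrite pevalB !pevalM -qp1 // => H; apply: (mulfI (q1U y Uy)).
      by apply/eqP; rewrite -subr_eq0; apply/eqP; apply: etrans H; ring.
    (* If F(y) != 0 then t(y) = 0; moving [y] inside [X] along the coordinate [t] keeps F nonzero
       and makes [t] nonzero, against t F = 0. *)
    apply: contrapT => /eqP Fy.
    have /eqP := tF y Xy Wy; rewrite pevalM mulf_eq0 (negPf Fy) orbF => /eqP ty.
    have [z [[[Wz Fz] sz] tz Qz]] := chart_perturb Jy (filterI (filterI
      (nbhs_interior Wy) (near_peval_neq0 Fy)) (near_peval_neq0 sy)) (leq_trans ck' kn).
    have Xz : X z.
      apply: sX => // i ic; rewrite Qz ?neq_ltn ?ic ?(leq_trans ic) //.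
      exact: QX0.
    have /eqP := tF z Xz Wz; rewrite pevalM mulf_eq0 (negPf Fz) orbF.
    by rewrite -/t ty in tz; rewrite (negPf tz).
  - move=> y Xy; have := dq y Xy; rewrite !(pevalB, pevalM) => E.
    transitivity (peval d' y * (peval d y * peval q y - peval t y * peval q' y)).
      by ring.
    by rewrite E mulr0.
have [q1 Dq1 q1U] := common_denominator.
have [d dx dX] := nakayama (germ_denominators_ideal x) (vanishing_ideal X) t0 step
  (denominators_germ x Dq1).
have [y Uy /= dy] := zariski_dense_euclidean Xchart Uopen Udense Xx (near_peval_neq0 dx).
have /eqP := dX y (UX Uy); rewrite pevalM mulf_eq0 (negPf dy) /=.
by apply/negP; apply: q1U.
Qed.

End MinimalCurve.

Lemma poles_finite :
  finite_set (X `&` [set x | forall q, denominators q -> peval q x = 0]).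
Proof.
apply: contrapT => inf.
have Zc : zariski_closed (X `&` [set x | forall q, denominators q -> peval q x = 0]).
  by apply: zariski_closedI => //; apply: zariski_closed_zeros.
have [C [Cc CZ Ci Cmin]] := minimal_infinite_closed Zc inf.
apply: (minimal_curve_absurd Cc Ci Cmin) => [y /CZ[]//|q Dq y /CZ[_]]; exact.
Qed.

End PolesFinite.

(** * Regular functions and continuity on X *)

Section RegularContinuous.
Variables (R : realType) (n : nat).
Local Notation poly := (rpoly R n).
Implicit Types (p q h d s : poly) (x y : 'rV[R]_n) (f g : 'rV[R]_n -> R)
  (A B V W X U S : set 'rV[R]_n).

(** Pointwise version of [regular_onP]: [V] has to contain the principal open set of [X] on which
    the fraction is defined. *)
Definition reg_at X V f x := exists p q, peval q x != 0 /\
  forall y, X y -> peval q y != 0 -> V y /\ peval q y * f y = peval p y.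

Lemma reg_at_poly X V f x h : reg_at X V f x -> reg_at X V (peval h) x.
Proof.
move=> [p [q [qx qP]]]; exists (q * h), q; split=> // y Xy qy.
by have [Vy _] := qP y Xy qy; rewrite pevalM.
Qed.

Lemma reg_atD X V f g x : reg_at X V f x -> reg_at X V g x ->
  reg_at X V (fun y => f y + g y) x.
Proof.
move=> [p [q [qx qP]]] [p' [q' [q'x q'P]]]; exists (p * q' + p' * q), (q * q').
split=> [|y Xy]; first by rewrite pevalM mulf_neq0.
rewrite pevalD !pevalM mulf_eq0 => /norP[qy q'y].
by have [Vy <-] := qP y Xy qy; have [_ <-] := q'P y Xy q'y; split=> //; ring.
Qed.

Lemma reg_atM X V f g x : reg_at X V f x -> reg_at X V g x ->
  reg_at X V (fun y => f y * g y) x.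
Proof.
move=> [p [q [qx qP]]] [p' [q' [q'x q'P]]]; exists (p * p'), (q * q').
split=> [|y Xy]; first by rewrite pevalM mulf_neq0.
rewrite !pevalM mulf_eq0 => /norP[qy q'y].
by have [Vy <-] := qP y Xy qy; have [_ <-] := q'P y Xy q'y; split=> //; ring.
Qed.

Lemma eq_reg_at X V f g x : (forall y, V y -> f y = g y) -> reg_at X V f x -> reg_at X V g x.
Proof.
move=> fg [p [q [qx qP]]]; exists p, q; split=> // y Xy qy.
by have [Vy E] := qP y Xy qy; rewrite -fg.
Qed.

Lemma reg_at_sub X V V' f x : V `<=` V' -> reg_at X V f x -> reg_at X V' f x.
Proof.
move=> VV' [p [q [qx qP]]]; exists p, q; split=> // y Xy qy.
by have [Vy E] := qP y Xy qy; split=> //; apply: VV'.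
Qed.

Lemma reg_at_restrict X V V' f s x : peval s x != 0 ->
  (forall y, X y -> peval s y != 0 -> V' y) -> reg_at X V f x -> reg_at X V' f x.
Proof.
move=> sx sV' [p [q [qx qP]]]; exists (s * p), (s * q).
split=> [|y Xy]; first by rewrite pevalM mulf_neq0.
rewrite !pevalM mulf_eq0 => /norP[sy qy]; have [_ <-] := qP y Xy qy.
by split; [apply: sV' | rewrite mulrA].
Qed.

(** The assumption on [f] supplies a neighbourhood of [x] contained in [V], which the empty sum
    requires. *)
Lemma reg_at_sum X V (I : Type) (r : seq I) (F : I -> 'rV[R]_n -> R) f x :
  reg_at X V f x -> (forall i, reg_at X V (F i) x) ->
  reg_at X V (fun y => \sum_(i <- r) F i y) x.
Proof.
move=> fx Fx; elim: r => [|i r IH].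
  apply: eq_reg_at (reg_at_poly 0 fx) => y _.
  by rewrite big_nil peval0.
by apply: eq_reg_at (reg_atD (Fx i) IH) => y _; rewrite big_cons.
Qed.

Lemma reg_atV X V f x : X x -> f x != 0 -> reg_at X V f x ->
  reg_at X V (fun y => (f y)^-1) x.
Proof.
move=> Xx fx [p [q [qx qP]]]; have [_ px] := qP x Xx qx.
exists (q * q), (q * p); split=> [|y Xy].
  by rewrite pevalM -px !mulf_neq0.
rewrite !pevalM mulf_eq0 => /norP[qy py]; have [Vy py'] := qP y Xy qy.
have fy : f y != 0 by apply: contra_neq py => fy; rewrite -py' fy mulr0.
by split=> //; rewrite -py'; field.
Qed.

Lemma regular_on_reg_at X V f : V `<=` X ->
  regular_on X V f <-> forall x, V x -> reg_at X V f x.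
Proof. by move=> VX; rewrite (regular_onP f VX). Qed.

Definition cont_at X f x := f y @[y --> within X (nbhs x)] --> f x.

Lemma cvg_withinP X f x (l : R) : f y @[y --> within X (nbhs x)] --> l <->
  forall e : R, 0 < e -> exists2 W, nbhs x W & forall y, X y -> W y -> `|f y - l| < e.
Proof.
rewrite cvgrPdistC_lt; split=> H e e0.
  have := H e e0; rewrite near_withinE => Hn.
  by exists (fun y => X y -> `|f y - l| < e) => // y Xy; apply.
have [W Wx WP] := H e e0; rewrite near_withinE.
by apply: filterS Wx => y Wy Xy; apply: WP.
Qed.

Lemma cont_at_poly X h x : cont_at X (peval h) x.
Proof. exact: (cvg_trans (cvg_app _ (cvg_within _)) (@peval_continuous R n h x)). Qed.

Lemma cont_atD X f g x : cont_at X f x -> cont_at X g x -> cont_at X (fun y => f y + g y) x.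
Proof. by move=> fx gx; apply: cvgD. Qed.

Lemma cont_atB X f g x : cont_at X f x -> cont_at X g x -> cont_at X (fun y => f y - g y) x.
Proof. by move=> fx gx; apply: cvgB. Qed.

Lemma cont_atM X f g x : cont_at X f x -> cont_at X g x -> cont_at X (fun y => f y * g y) x.
Proof. by move=> fx gx; apply: cvgM. Qed.

Lemma cont_at_sum X (I : Type) (r : seq I) (F : I -> 'rV[R]_n -> R) x :
  (forall i, cont_at X (F i) x) -> cont_at X (fun y => \sum_(i <- r) F i y) x.
Proof.
move=> Fx; elim: r => [|i r IH].
  have -> : (fun y => \sum_(i <- [::]) F i y) = fun=> 0.
    by apply/funext => y; rewrite big_nil.
  exact: cvg_cst.
have -> : (fun y => \sum_(j <- i :: r) F j y) = fun y => F i y + \sum_(j <- r) F j y.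
  by apply/funext => y; rewrite big_cons.
exact: cont_atD.
Qed.

Lemma reg_at_cont X V f x : X x -> reg_at X V f x -> cont_at X f x.
Proof.
move=> Xx [p [q [qx qP]]].
have pq : (fun y => peval p y / peval q y) y @[y --> within X (nbhs x)] --> peval p x / peval q x.
  by apply: cvgM; [apply: cont_at_poly | apply: cvgV => //; apply: cont_at_poly].
apply/cvg_withinP => e e0; have [W Wx WP] := (cvg_withinP _ _ _ _).1 pq e e0.
exists (W `&` [set y | peval q y != 0]).
  by apply: filterI => //; apply: near_peval_neq0.
have fE y : X y -> peval q y != 0 -> f y = peval p y / peval q y.
  by move=> Xy qy; have [_ <-] := qP y Xy qy; field.
by move=> y Xy [Wy qy]; rewrite !fE //; apply: WP.
Qed.

Lemma dense_cont_bound X U W f y (e : R) :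
  (forall x V, X x -> nbhs x V -> exists2 z, U z & V z) -> U `<=` X ->
  (forall z, U z -> W z -> `|f z| <= e) -> X y -> nbhs y W -> cont_at X f y -> `|f y| <= e.
Proof.
move=> dense UX fe Xy Wy /cvg_withinP fy; rewrite leNgt; apply/negP => ey.
have [|V Vy VP] := fy (`|f y| - e); first by rewrite subr_gt0.
have [z Uz [Wz Vz]] := dense y _ Xy (filterI Wy Vy).
have := VP z (UX z Uz) Vz; have := fe z Uz Wz.
have := ler_normD (f y - f z) (f z); rewrite subrK distrC; lra.
Qed.

(** A new point [a] is handled by adding a multiple of a polynomial that vanishes on [l] but not at
    [a]. *)
Lemma interpolation (l : seq 'rV[R]_n) (v : 'rV[R]_n -> R) :
  exists c : poly, forall x, x \in l -> peval c x = v x.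
Proof.
elim: l => [|a l [c cP]]; first by exists 0.
have [al|al] := boolP (a \in l).
  by exists c => x; rewrite inE => /predU1P[->|]; apply: cP.
have lc : zariski_closed [set` l] by apply: zariski_closed_finite; apply: finite_seq.
have [h lh ha] : exists2 h, vanishing [set` l] h & peval h a != 0.
  by apply: zariski_closed_not => //; apply/negP.
exists (c + mpoly.mpolyC n ((v a - peval c a) / peval h a) * h) => x.
rewrite inE pevalD pevalM pevalC => /predU1P[->|xl].
  by rewrite divfK // addrC subrK.
by rewrite (lh x xl) mulr0 addr0 cP.
Qed.

Lemma zariski_closed_seq (I : eqType) (l : seq I) (A : I -> set 'rV[R]_n) :
  (forall i, zariski_closed (A i)) -> zariski_closed [set x | exists2 i, i \in l & A i x].
Proof.
move=> Ac; apply/zariski_closedP => x H; apply: contrapT => /forall2NP nA.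
have ex_h i : exists h, i \in l -> vanishing (A i) h /\ peval h x != 0.
  have [il|] := boolP (i \in l); last by exists 0.
  have [//|nAi] := nA i; have [h Ah hx] := zariski_closed_not (Ac i) nAi.
  by exists h.
have [h hP] := choice ex_h.
have /eqP : peval (\prod_(i <- l) h i) x = 0.
  apply: H => y [i il Aiy]; rewrite peval_prod; apply/eqP; rewrite prodf_seq_eq0.
  by apply/hasP; exists i => //=; apply/eqP; apply: (hP i il).1.
apply/negP; rewrite peval_prod prodf_seq_neq0; apply/allP => i il.
by case: (hP i il).
Qed.

(** If [Z] contains X minus A and B, then the closed union of Z and B contains X minus A, hence X;
    so Z contains X minus B. *)
Lemma zariski_dense_setD X A B : zariski_closed B ->
  zariski_dense_in X (X `\` A) -> zariski_dense_in X (X `\` B) ->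
  zariski_dense_in X (X `\` (A `|` B)).
Proof.
move=> Bc dA dB Z Zc ZU; apply: dB => // x [Xx nBx].
suff [//|] : (Z `|` B) x by [].
apply: (dA (Z `|` B)) => //; first exact: zariski_closedU.
move=> y [Xy nAy]; have [By|nBy] := pselect (B y); first by right.
by left; apply: ZU; split=> // -[].
Qed.

Lemma zariski_dense_setD_seq X (I : eqType) (l : seq I) (A : I -> set 'rV[R]_n) :
  (forall i, zariski_closed (A i)) -> (forall i, zariski_dense_in X (X `\` A i)) ->
  zariski_dense_in X (X `\` [set x | exists2 i, i \in l & A i x]).
Proof.
move=> Ac Ad; elim: l => [|i l IH].
  by move=> Z _ ZX x Xx; apply: ZX; split=> // -[].
have -> : [set x | exists2 j, j \in i :: l & A j x] =
    A i `|` [set x | exists2 j, j \in l & A j x].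
  apply/seteqP; split=> x /=.
    by move=> [j + Ajx]; rewrite inE => /predU1P[<-|jl]; [left | right; exists j].
  move=> [Aix|[j jl Ajx]]; first by exists i; rewrite ?inE ?eqxx.
  by exists j; rewrite // inE jl orbT.
by apply: zariski_dense_setD; [apply: zariski_closed_seq | |].
Qed.

Lemma pole_set_dense X f : zariski_closed X -> continuous_rational X f ->
  zariski_dense_in X (X `\` pole_set X f).
Proof.
move=> Xc [_ [U [[A Ac UE] Ud freg]]] Z Zc ZU; apply: Ud => // x Ux; apply: ZU.
have [Xx nAx] : (X `\` A) x by rewrite -UE.
split=> // /(_ (X `&` A)) H; apply: nAx; apply: (proj2 (H _)).
split; first exact: zariski_closedI; first by move=> y [].
suff -> : X `\` (X `&` A) = U by [].
by rewrite UE setDIr setDv set0U.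
Qed.

End RegularContinuous.

(** * Solving the linear equation *)

Lemma ler_norm_mul_sq (R : realType) (a b t : R) :
  a ^+ 2 <= t -> b ^+ 2 <= t -> `|a * b| <= t.
Proof.
move=> at_ bt; rewrite ler_norml.
have := sqr_ge0 (a + b); have := sqr_ge0 (a - b).
rewrite sqrrB sqrrD !mulr2n; set u := a * b; set v := a ^+ 2 in at_ *; set w := b ^+ 2 in bt *.
by move=> H1 H2; apply/andP; split; lra.
Qed.

Section LinearEquation.
Variables (R : realType) (n : nat).
Local Notation poly := (rpoly R n).
Implicit Types (p q d s : poly) (x y : 'rV[R]_n) (A B V W U S : set 'rV[R]_n).
Variable X : set 'rV[R]_n.
Hypotheses (Xclosed : zariski_closed X) (Xchart : locally_chartable X).

(** [S] is the set of common zeros of the denominators on [X], finite by [poles_finite]. Off [S],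
    the value of [H] is that of any fraction p / q; two fractions agree because p q' - p' q vanishes
    on [U], hence on [X] by density. *)
Lemma extend_bounded_regular U (h : 'rV[R]_n -> R) :
  zariski_open_in X U -> zariski_dense_in X U -> regular_on X U h ->
  (forall x, X x -> exists (K : R) W, nbhs x W /\ forall y, U y -> W y -> `|h y| <= K) ->
  exists S H, [/\ finite_set S, U `&` S = set0, forall x, U x -> H x = h x &
    forall x, X x -> ~ S x -> reg_at X (X `\` S) H x].
Proof.
move=> Uo Ud hreg hbd; have UX : U `<=` X by case/zariski_open_inP: Uo.
pose S := X `&` [set x | forall q, denominators U h q -> peval q x = 0].
have Sfin : finite_set S := poles_finite Xclosed Xchart Uo Ud hreg hbd.
have quot x : X x -> ~ S x -> exists p q, peval q x != 0 /\
    forall y, U y -> peval q y * h y = peval p y.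
  move=> Xx nSx; apply: contrapT => H; apply: nSx; split=> // q [p qp].
  by apply: contrapT => /eqP qx; apply: H; exists p, q.
have value x : exists v, X x -> ~ S x -> exists p q, [/\ peval q x != 0,
    forall y, U y -> peval q y * h y = peval p y & v = peval p x / peval q x].
  have [[Xx nSx]|nx] := pselect (X x /\ ~ S x); last by exists 0 => Xx nSx; case: nx.
  by have [p [q [qx qP]]] := quot x Xx nSx; exists (peval p x / peval q x) => _ _; exists p, q.
have [H HP] := choice value.
have US : U `&` S = set0.
  apply/seteqP; split=> // x [Ux [_ Sx]].
  by have [q /Sx qx /eqP] := denominators_unit Uo hreg Ux.
have nS x : U x -> ~ S x by move=> Ux Sx; have : (U `&` S) x by []; rewrite US.
exists S, H; split=> // [x Ux|x Xx nSx].
  have [p [q [qx qP ->]]] := HP x (UX x Ux) (nS x Ux).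
  by rewrite -qP // mulrAC divff ?mul1r.
have [p [q [qx qP _]]] := HP x Xx nSx.
have [s sS sx] := zariski_closed_not (zariski_closed_finite Sfin) nSx.
exists (s * p), (s * q); split=> [|y Xy]; first by rewrite pevalM mulf_neq0.
rewrite !pevalM mulf_eq0 => /norP[sy qy].
have nSy : ~ S y by move=> /sS/eqP; rewrite (negPf sy).
split=> //; have [p' [q' [q'y q'P ->]]] := HP y Xy nSy.
have : X `<=` [set z | peval (p * q' - p' * q) z = 0].
  apply: Ud => [|z Uz].
    exists [set (p * q' - p' * q)].
    by apply/seteqP; split=> [z /= zE w -> //|z /= /(_ _ erefl)].
  by rewrite /= pevalB !pevalM -qP // -q'P //; ring.
move=> /(_ y Xy)/=; rewrite pevalB !pevalM => /eqP; rewrite subr_eq0 => /eqP E.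
by rewrite -mulrA; congr (_ * _); rewrite mulrA [peval q y * _]mulrC -E; field.
Qed.

Variables (r : nat) (f : 'I_r -> 'rV[R]_n -> R) (phi : 'rV[R]_n -> R).
Hypotheses (f_cr : forall i, continuous_rational X (f i))
  (phi_cr : continuous_rational X phi).
Hypothesis PT : pointwise_test X f phi.

(** [Some i] stands for f_i and [None] for phi, so that the quotients b_ij and a_i are treated
    together. *)
Let data (o : option 'I_r) := if o is Some i then f i else phi.

Let poles := [set x | exists2 o, o \in enum {: option 'I_r} & pole_set X (data o) x].

Let U0 := X `\` poles.

Let data_cr o : continuous_rational X (data o).
Proof. by case: o. Qed.

Let poles_closed : zariski_closed poles.
Proof. by apply: zariski_closed_seq => o; case: (admissible_pole_set (data o) Xclosed). Qed.

Let U0_dense : zariski_dense_in X U0.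
Proof.
apply: zariski_dense_setD_seq => o; last exact: pole_set_dense.
by case: (admissible_pole_set (data o) Xclosed).
Qed.

Let closed_setD_reg_at A (g : 'rV[R]_n -> R) x : zariski_closed A -> A `<=` X ->
  regular_on X (X `\` A) g -> X x -> ~ A x -> reg_at X (X `\` A) g x.
Proof.
by move=> Ac AX /regular_on_reg_at H Xx nAx; apply: H => // y [].
Qed.

Let data_reg o x : U0 x -> reg_at X U0 (data o) x.
Proof.
move=> [Xx nPx]; have [Pc PX Preg] := admissible_pole_set (data o) Xclosed.
have [s sP sx] := zariski_closed_not poles_closed nPx.
apply: (reg_at_restrict sx) => [y Xy sy|].
  by split=> // /sP/eqP; rewrite (negPf sy).
apply: closed_setD_reg_at Pc PX Preg Xx _ => Px; apply: nPx.
by exists o; rewrite ?mem_enum.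
Qed.

Let sq x := \sum_(j < r) f j x * f j x.

Let sq_eq0 x : sq x = 0 -> forall i, f i x = 0.
Proof.
move=> sx i; move/psumr_eq0P : (sx) => /(_ (fun i _ => sqr_ge0 _))/(_ i isT)/eqP.
by rewrite mulf_eq0 orbb => /eqP.
Qed.

Let M := U0 `&` [set x | sq x != 0].

(** The Zariski closure of [M]. All f_j vanish on [U0] outside it; these points are added to [M],
    which alone misses the components of [X] where all f_j are 0. *)
Let clM := [set x | forall h, vanishing M h -> peval h x = 0].

Let U := M `|` (U0 `\` clM).

Let UX : U `<=` X.
Proof. by move=> x [[[]]|[[]]]. Qed.

Let sq_reg x : U0 x -> reg_at X U0 sq x.
Proof.
move=> U0x; apply: (reg_at_sum _ (data_reg None U0x)) => i.
by apply: reg_atM; apply: (data_reg (Some i)).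
Qed.

Let M_open x : M x -> exists2 s, peval s x != 0 & forall y, X y -> peval s y != 0 -> M y.
Proof.
move=> [U0x sx]; have [p [q [qx qP]]] := sq_reg U0x.
have [_ px] := qP x U0x.1 qx.
exists (q * p); first by rewrite pevalM -px !mulf_neq0.
move=> y Xy; rewrite pevalM mulf_eq0 => /norP[qy py]; have [U0y py'] := qP y Xy qy.
by split=> //; apply: contra_neq py => /= sy; rewrite -py' sy mulr0.
Qed.

Let rest_open x : (U0 `\` clM) x -> exists2 s, peval s x != 0 &
  forall y, X y -> peval s y != 0 -> (U0 `\` clM) y.
Proof.
move=> [[Xx nPx] nMx].
have [s sP sx] := zariski_closed_not poles_closed nPx.
have [s' sM s'x] := zariski_closed_not (zariski_closed_zeros (vanishing M)) nMx.
exists (s * s') => [|y Xy]; first by rewrite pevalM mulf_neq0.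
rewrite pevalM mulf_eq0 => /norP[sy s'y]; split.
  by split=> // /sP/eqP; rewrite (negPf sy).
by move=> /sM/eqP; rewrite (negPf s'y).
Qed.

Let U_open : zariski_open_in X U.
Proof.
apply/zariski_open_inP; split=> // x [/M_open|/rest_open] [s sx sU].
  by exists s => // y Xy sy; left; apply: sU.
by exists s => // y Xy sy; right; apply: sU.
Qed.

Let U_dense : zariski_dense_in X U.
Proof.
move=> Z Zc UZ; apply: U0_dense => // x U0x.
have [Mx|nMx] := pselect (clM x); last by apply: UZ; right.
move/zariski_closedP: Zc; apply => h Zh; apply: Mx => y My.
by apply: Zh; apply: UZ; left.
Qed.

(* Where all the f_j vanish this is 0, as division by 0 gives 0; hence the quotients
   are regular on U, which also meets the components of X on which all f_j are 0. *)
Let quotient i o x := f i x * data o x / sq x.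

Let quotient_reg i o : regular_on X U (quotient i o).
Proof.
apply/(regular_on_reg_at _ UX) => x [Mx|Nx].
  have [s sx sM] := M_open Mx; have [U0x sqx] := Mx.
  apply: (@reg_at_sub _ _ _ M); first by move=> y; left.
  apply: (reg_at_restrict sx sM); apply: reg_atM.
    by apply: reg_atM; [apply: (data_reg (Some i)) | apply: data_reg].
  by apply: reg_atV; [case: U0x | | apply: sq_reg].
have [s sx sN] := rest_open Nx.
apply: (@reg_at_sub _ _ _ (U0 `\` clM)); first by move=> y; right.
have U0x : U0 x by case: Nx.
apply: eq_reg_at (reg_at_restrict sx sN (reg_at_poly 0 (data_reg None U0x))) => y [U0y nMy].
have sy : sq y = 0.
  apply: contrapT => /eqP sy; apply: nMy => h Mh.
  by apply: Mh.
by rewrite peval0 /quotient (sq_eq0 sy) !mul0r.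
Qed.

Let quotient_le1 i j x : `|quotient i (Some j) x| <= 1.
Proof.
rewrite /quotient /=; have [sx|sx] := eqVneq (sq x) 0.
  by rewrite (sq_eq0 sx) !mul0r normr0.
have sq0 : 0 < sq x.
  by rewrite lt_neqAle eq_sym sx /sq sumr_ge0 // => k _; rewrite -expr2 sqr_ge0.
rewrite normf_div (gtr0_norm sq0) ler_pdivrMr // mul1r.
have le_sq k : f k x ^+ 2 <= sq x.
  rewrite /sq (bigD1 k) //= -expr2 lerDl sumr_ge0 // => l _.
  by rewrite -expr2 sqr_ge0.
exact: ler_norm_mul_sq.
Qed.

Let quotientE i x (psi : 'I_r -> R) : phi x = \sum_j psi j * f j x ->
  quotient i None x = \sum_j psi j * quotient i (Some j) x.
Proof.
move=> phix; rewrite /quotient /= phix mulr_sumr mulr_suml; apply: eq_bigr => j _.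
by rewrite mulrCA !mulrA.
Qed.

(** The pointwise test at [x] writes a_i as the sum of the psi_j b_ij, where the psi_j are bounded
    near [x] and |b_ij| <= 1. *)
Let quotient_bounded i o x : X x -> exists (K : R) W, nbhs x W /\
  forall y, U y -> W y -> `|quotient i o y| <= K.
Proof.
case: o => [j|] Xx.
  by exists 1, setT; split=> [|y _ _]; [apply: filterT | apply: quotient_le1].
have [psi [psi_cont psiE]] := PT Xx.
have near_psi j : \forall y \near x, X y -> `|psi j y| <= `|psi j x| + 1.
  have /cvg_withinP/(_ 1 ltr01)[W Wx WP] := psi_cont j.
  apply: filterS Wx => y Wy Xy; have := WP y Xy Wy.
  have := ler_normD (psi j y - psi j x) (psi j x); rewrite subrK; lra.
exists (\sum_j (`|psi j x| + 1)), [set y | forall j, X y -> `|psi j y| <= `|psi j x| + 1].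
split; first exact: (@filter_forall _ _ _ (nbhs x) _ near_psi).
move=> y Uy Wy; have Xy := UX Uy; rewrite (quotientE i (psiE y Xy)).
apply: le_trans (ler_norm_sum _ _ _) _; apply: ler_sum => j _.
by rewrite normrM -[leRHS]mulr1 ler_pM ?Wy ?quotient_le1.
Qed.

Let Udense_euclidean x W : X x -> nbhs x W -> exists2 z, U z & W z.
Proof. exact: zariski_dense_euclidean. Qed.

(** Where all f_j vanish the left side is 0, and so is phi by the pointwise test. *)
Let sum_quotient o x : X x -> \sum_i quotient i o x * f i x = data o x.
Proof.
move=> Xx; have [sx|sx] := eqVneq (sq x) 0.
  rewrite big1; last by move=> i _; rewrite (sq_eq0 sx) mulr0.
  case: o => [j|] /=; first by rewrite (sq_eq0 sx).
  have [psi [_ psiE]] := PT Xx; rewrite psiE // big1 // => i _.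
  by rewrite (sq_eq0 sx) mulr0.
transitivity (\sum_i f i x * f i x * (data o x / sq x)).
  by apply: eq_bigr => i _; rewrite /quotient; ring.
by rewrite -mulr_suml -/(sq x); field.
Qed.

Lemma continuous_rational_solution : exists g : 'I_r -> 'rV[R]_n -> R,
  [/\ forall i, continuous_rational X (g i),
      forall x, X x -> phi x = \sum_(i < r) g i x * f i x &
      forall i, finite_set (pole_set X (g i)) /\
        pole_set X (g i) `<=`
          zero_set X f `|` (\bigcup_(j in [set: 'I_r]) pole_set X (f j))
            `|` pole_set X phi].
Proof.
have ext (io : 'I_r * option 'I_r) := extend_bounded_regular U_open U_dense
  (quotient_reg io.1 io.2) (quotient_bounded io.1 io.2).
have [S_ S_P] := choice ext; have [H HP] := choice S_P.
pose S := X `&` \bigcup_(io in [set: 'I_r * option 'I_r]) S_ io.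
have Sfin : finite_set S.
  apply: (sub_finite_set (@subIsetr _ _ _)); apply: bigcup_finite => // io _.
  by case: (HP io).
have Sclosed := zariski_closed_finite Sfin.
have US x : U x -> ~ S x.
  move=> Ux [_ [io _ Sx]]; have [_ US _ _] := HP io.
  by have : (U `&` S_ io) x by []; rewrite US.
have HU i o x : U x -> H (i, o) x = quotient i o x by case: (HP (i, o)) => _ _ + _; apply.
have Hreg io x : X x -> ~ S x -> reg_at X (X `\` S) (H io) x.
  move=> Xx nSx; have [s sS sx] := zariski_closed_not Sclosed nSx.
  apply: (reg_at_restrict sx) => [y Xy sy|].
    by split=> // /sS/eqP; rewrite (negPf sy).
  have [_ _ _ Hio] := HP io; apply: Hio => // Sx.
  by apply: nSx; split=> //; exists io.
have ex_psi x : exists psi : 'I_r -> 'rV[R]_n -> R, X x ->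
    (forall i, cont_at X (psi i) x) /\
    forall y, X y -> phi y = \sum_(i < r) psi i y * f i y.
  have [Xx|nXx] := pselect (X x); last by exists (fun _ _ => 0).
  by have [psi psiP] := PT Xx; exists psi.
have [psi psiP] := choice ex_psi.
have ex_c i : exists c : poly, forall x, S x -> peval c x = psi x i x.
  have /finite_seqP[l lE] := Sfin.
  have [c cP] := interpolation l (fun x => psi x i x).
  by exists c => x; rewrite lE => /cP.
have [c cP] := choice ex_c.
(* At x in S, the values psi x j x solve the equation up to o(|f|), so that
   [g0 i - c i], which is f_i (phi - sum_j c_j f_j) / |f|^2, tends to 0. *)
pose g0 i x := peval (c i) x + (H (i, None) x - \sum_j peval (c j) x * H (i, Some j) x).
pose g i x := if `[< S x >] then peval (c i) x else g0 i x.
have gS i x : S x -> g i x = peval (c i) x by move=> Sx; rewrite /g asboolT.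
have gnS i x : ~ S x -> g i x = g0 i x by move=> Sx; rewrite /g asboolF.
have g_reg i x : X x -> ~ S x -> reg_at X (X `\` S) (g i) x.
  move=> Xx nSx; apply: (@eq_reg_at _ _ _ _ (fun y => peval (c i) y + (H (i, None) y +
    peval (mpoly.mpolyC n (-1)) y * \sum_j peval (c j) y * H (i, Some j) y))).
    by move=> y [_ nSy]; rewrite gnS // /g0 pevalC mulN1r.
  have Hx := Hreg (i, None) x Xx nSx.
  apply: reg_atD; first exact: reg_at_poly Hx.
  apply: reg_atD => //; apply: reg_atM; first exact: reg_at_poly Hx.
  apply: (reg_at_sum _ Hx) => j; apply: reg_atM; first exact: reg_at_poly Hx.
  exact: Hreg.
(* The expansion of phi given by the pointwise test at [x] is substituted in a_i. For [x] in [S] the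
   factors psi_j - c_j tend to 0 at [x], and the quotients are bounded by 1. *)
have g_U i x z (Xx : X x) : U z -> g i z - peval (c i) z =
    \sum_j (psi x j z - peval (c j) z) * quotient i (Some j) z.
  move=> Uz; rewrite gnS; last exact: US.
  rewrite /g0 HU // (quotientE i ((psiP x Xx).2 z (UX Uz))) addrC addKr -sumrB.
  by apply: eq_bigr => j _; rewrite HU // mulrBl.
have g_cont i x : X x -> cont_at X (g i) x.
  move=> Xx; have [Sx|nSx] := pselect (S x); last exact: reg_at_cont Xx (g_reg i x Xx nSx).
  (* Half of [e] bounds g_i - c_i, the other half the variation of c_i; [r.+1] instead of [r] avoids
     a division by zero for r = 0. *)
  apply/cvg_withinP => e e0; pose e' := e / 2 / r.+1%:R.
  have e'0 : 0 < e' by rewrite /e' !divr_gt0 // ltr0n.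
  have near_psi j : \forall y \near x, X y -> `|psi x j y - peval (c j) y| <= e'.
    have /cvg_withinP/(_ e' e'0)[W Wx WP] :=
      cont_atB ((psiP x Xx).1 j) (@cont_at_poly R n X (c j) x).
    apply: filterS Wx => y Wy Xy; have := WP y Xy Wy.
    by rewrite /= (cP j x Sx) subrr subr0 => /ltW.
  pose W := [set y | forall j, X y -> `|psi x j y - peval (c j) y| <= e'].
  have Wx : nbhs x W by exact: (@filter_forall _ _ _ (nbhs x) _ near_psi).
  have gU z : U z -> W z -> `|g i z - peval (c i) z| <= e / 2.
    move=> Uz Wz; rewrite (g_U i x z Xx Uz); apply: le_trans (ler_norm_sum _ _ _) _.
    apply: (@le_trans _ _ (\sum_(j < r) e')).
      apply: ler_sum => j _; rewrite normrM -[leRHS]mulr1.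
      by rewrite ler_pM ?quotient_le1 ?Wz //; apply: UX.
    have -> : \sum_(j < r) e' = e / 2 * (r%:R / r.+1%:R).
      by rewrite sumr_const card_ord -[LHS]mulr_natr [RHS]mulrA [LHS]mulrAC.
    by rewrite ler_piMr ?divr_ge0 ?ler_pdivrMr ?ltr0n ?mul1r ?ler_nat // ltW.
  have /cvg_withinP/(_ (e / 2))[|V Vx VP] := @cont_at_poly R n X (c i) x.
    by rewrite divr_gt0.
  exists (W° `&` V); first by apply: filterI => //; apply: nbhs_interior.
  move=> y Xy [Wy Vy]; rewrite (gS i x Sx).
  have H1 : `|g i y - peval (c i) y| <= e / 2.
    have [Sy|nSy] := pselect (S y); first by rewrite gS // subrr normr0 divr_ge0 // ltW.
    apply: (dense_cont_bound Udense_euclidean UX gU Xy Wy).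
    by apply: cont_atB; [apply: reg_at_cont Xy (g_reg i y Xy nSy) | apply: cont_at_poly].
  have := VP y Xy Vy; have := ler_normD (g i y - peval (c i) y) (peval (c i) y - peval (c i) x).
  by rewrite addrA subrK; lra.
have S_admissible i : admissible_pole X (g i) S.
  split=> //; first by move=> x [].
  by apply/regular_on_reg_at => [x []//|x [Xx nSx]]; apply: g_reg.
have polesS i : pole_set X (g i) `<=` S by move=> x; apply.
exists g; split=> [i|x Xx|i].
- split; first by apply/subspace_continuousP => x; apply: g_cont.
  exists (X `\` S); split; first by exists S.
    move=> Z Zc SZ; apply: U_dense => // x Ux; apply: SZ; split; first exact: UX.
    exact: US.
  by case: (S_admissible i).
(* By continuity and density the equation is only checked on [U]. There sum_i a_i f_i = phi and
   sum_i b_ij f_i = f_j, so the terms in the c_j cancel. *)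
- apply/eqP; rewrite -subr_eq0 -normr_le0.
  apply: (dense_cont_bound (W := setT) (f := fun x => phi x - \sum_(i < r) g i x * f i x)
    Udense_euclidean UX _ Xx); last 2 first.
  + exact: filterT.
  + apply: cont_atB; first by case: phi_cr => /subspace_continuousP + _; apply.
    apply: cont_at_sum => i; apply: cont_atM; first exact: g_cont.
    by case: (f_cr i) => /subspace_continuousP + _; apply.
  move=> z Uz _; have Xz := UX Uz.
  suff -> : \sum_(i < r) g i z * f i z = phi z by rewrite subrr normr0.
  rewrite -[RHS](sum_quotient None Xz).
  have gz i : g i z = peval (c i) z + (quotient i None z -
      \sum_j peval (c j) z * quotient i (Some j) z).
    rewrite gnS; last exact: US.
    by rewrite /g0 HU //; congr (_ + (_ - _)); apply: eq_bigr => j _; rewrite HU.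
  under eq_bigr => i _ do rewrite gz mulrDl mulrBl.
  rewrite big_split sumrB /= addrCA; apply/eqP; rewrite -subr_eq0 addrAC subrr add0r subr_eq0.
  apply/eqP; under [RHS]eq_bigr => i _ do rewrite mulr_suml.
  rewrite exchange_big; apply: eq_bigr => j _ /=.
  rewrite -[f j z]/(data (Some j) z) -(sum_quotient (Some j) Xz) mulr_sumr.
  by apply: eq_bigr => i _; rewrite mulrA.
- split; first exact: sub_finite_set (@polesS i) Sfin.
  move=> x /polesS Sx; have Xx : X x by case: Sx.
  have [[k _ Px]|nPx] := pselect (poles x).
    by case: k Px => [j|] Px; [left; right; exists j | right].
  (* A point of [S] outside the poles with some f_j nonzero would lie in [M], hence in [U], which
     misses [S]. *)
  left; left; split=> // j; apply: sq_eq0; apply: contrapT => /eqP sx.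
  by apply: (US x) Sx; left; split.
Qed.

End LinearEquation.

Unset Implicit Arguments.

Theorem theorem1p6 (R : realType) (n : nat) (X : set 'rV[R]_n)
    (hX : nonsingular_surface X)
    (r : nat) (f : 'I_r -> 'rV[R]_n -> R)
    (hf : forall i, continuous_rational X (f i))
    (phi : 'rV[R]_n -> R) (hphi : continuous_rational X phi) :
  ((exists g : 'I_r -> 'rV[R]_n -> R,
      (forall i, continuous_rational X (g i)) /\
      (forall x, X x -> phi x = \sum_(i < r) g i x * f i x))
   <-> pointwise_test X f phi)
  /\
  (pointwise_test X f phi ->
   exists g : 'I_r -> 'rV[R]_n -> R,
     [/\ forall i, continuous_rational X (g i),
         forall x, X x -> phi x = \sum_(i < r) g i x * f i x &
         forall i, finite_set (pole_set X (g i)) /\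
           pole_set X (g i) `<=`
             zero_set X f `|` (\bigcup_(j in [set: 'I_r]) pole_set X (f j))
               `|` pole_set X phi]).
Proof.
have Xclosed : zariski_closed X by case: hX.
have Xchart := nonsingular_surface_chartable hX.
split; last exact: continuous_rational_solution.
split=> [[g [g_cr gE]] p Xp|PT].
  exists g; split=> // i.
  by case: (g_cr i) => /subspace_continuousP g_cont _; apply: g_cont.
have [g [g_cr gE _]] := continuous_rational_solution Xclosed Xchart hf hphi PT.
by exists g.
Qed.
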